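(* Let $\mathbb{T}$ be a time scale with $\inf\mathbb{T}=a\in\mathbb{T}$, $\sup\mathbb{T}=b\in\mathbb{T}$, $a<b$ and $\mathbb{T}\cap(a,b)\neq\emptyset$, and let $I=[a,b]\cap\mathbb{T}$. Let $L_\Delta,L_\nabla:\mathbb{T}\times\mathbb{R}^2\to\mathbb{R}$ be two smooth functions which are jointly convex (respectively, jointly concave) with respect to the second and third arguments for any $t\in I$, and let $\gamma_1,\gamma_2\ge0$ and $\alpha,\beta\in\mathbb{R}$. Let $$\mathcal{L}(y)=\gamma_1\int_a^b L_\Delta\left(t,y^\sigma(t),y^\Delta(t)\right)\Delta t+\gamma_2\int_a^b L_\nabla\left(t,y^\rho(t),y^\nabla(t)\right)\nabla t .$$ Suppose $\hat y\in C^1_\diamond(I,\mathbb{R})$ satisfies $\hat y(a)=\alpha$, $\hat y(b)=\beta$, and satisfies, for some constant $c$ and all $t\in I_\kappa$, $$\gamma_1\left(\partial_3L_\Delta[\hat y](\rho(t))-\int_a^{\rho(t)}\partial_2L_\Delta[\hat y](\tau)\,\Delta\tau\right)+\gamma_2\left(\partial_3L_\nabla\{\hat y\}(t)-\int_a^{t}\partial_2L_\nabla\{\hat y\}(\tau)\,\nabla\tau\right)=c$$ (equivalently, for some constant $c'$ and all $t\in I^\kappa$, $$\gamma_1\left(\partial_3L_\Delta[\hat y](t)-\int_a^{t}\partial_2L_\Delta[\hat y](\tau)\,\Delta\tau\right)+\gamma_2\left(\partial_3L_\nabla\{\hat y\}(\sigma(t))-\int_a^{\sigma(t)}\partial_2L_\nabla\{\hat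 y\}(\tau)\,\nabla\tau\right)=c').$$ Then $\hat y$ is a global minimizer (respectively, global maximizer) of $\mathcal{L}$ among all $y\in C^1_\diamond(I,\mathbb{R})$ with $y(a)=\alpha$, $y(b)=\beta$; that is, $\mathcal{L}(\hat y)\le\mathcal{L}(y)$ (respectively, $\mathcal{L}(\hat y)\ge\mathcal{L}(y)$) for all such $y$.
   Context: A time scale $\mathbb{T}$ is a nonempty closed subset of $\mathbb{R}$, with forward and backward jump operators $\sigma,\rho$ (with the conventions $\sigma(b)=b$, $\rho(a)=a$ when $a=\min\mathbb{T}$, $b=\max\mathbb{T}$). $y^\sigma=y\circ\sigma$, $y^\rho=y\circ\rho$; $y^\Delta$, $y^\nabla$ are the delta and nabla derivatives, and $\int\cdot\,\Delta t$, $\int\cdot\,\nabla t$ the delta and nabla integrals, in the standard sense of time scale calculus. $I^\kappa=I\setminus(\rho(b),b]$, $I_\kappa=I\setminus[a,\sigma(a))$. $C^1_\diamond(I,\mathbb{R})$ is the class of functions $y:I\to\mathbb{R}$ with $y^\Delta$ continuous on $I^\kappa$ and $y^\nabla$ continuous on $I_\kappa$. Notation: $[y](t)=(t,y^\sigma(t),y^\Delta(t))$ and $\{y\}(t)=(t,y^\rho(t),y^\nabla(t))$; $\partial_iL$ is the partial derivative of $L(\cdot,\cdot,\cdot)$ with respect to its $i$th variable; $\partial_iL_\Delta[y](t)$ means $\partial_iL_\Delta$ evaluated at $[y](t)$, and similarly $\partial_iL_\nabla\{y\}(t)$.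
   Formalization: The two Euler–Lagrange equations are not equivalent in general (they can differ at left-scattered, right-dense points, e.g. on {0}∪[1,2]); the formal theorem assumes that at least one of them holds, proves the conclusion under either, and does not assert the equivalence. *)

(* Defs.v *)
From HB Require Import structures.
From mathcomp Require Import all_boot all_order all_algebra.
From mathcomp Require Import all_classical all_reals all_analysis.

Set Implicit Arguments.
Unset Strict Implicit.
Unset Printing Implicit Defensive.

Import Order.TTheory GRing.Theory Num.Theory.
Import numFieldNormedType.Exports.

Local Open Scope classical_set_scope.
Local Open Scope ring_scope.

(* Time scale calculus on a bounded time scale X, that is, a nonempty closed
   bounded set of reals. A function on X is represented by a total function
   R -> R; only its values on X matter below. *)
Section TimeScale.
Context {R : realType}.
Implicit Types (X : set R) (f F y : R -> R) (t r s d : R).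

Definition time_scale X := X !=set0 /\ closed X.

(* The case distinction is needed because inf set0 = sup set0 = 0 in the
   library; it gives sigma (max X) = max X and rho (min X) = min X. *)
Definition sigma X t : R :=
  if `[< exists2 s, X s & t < s >] then inf [set s | X s /\ t < s] else t.

Definition rho X t : R :=
  if `[< exists2 s, X s & s < t >] then sup [set s | X s /\ s < t] else t.

Definition upper_kappa X : set R := X `\` `]rho X (sup X), sup X].

Definition lower_kappa X : set R := X `\` `[inf X, sigma X (inf X)[.

Definition is_delta_deriv X f t d :=
  forall e : R, 0 < e -> \forall s \near within X (nbhs t),
    `|f (sigma X t) - f s - d * (sigma X t - s)| <= e * `|sigma X t - s|.

Definition is_nabla_deriv X f t d :=
  forall e : R, 0 < e -> \forall s \near within X (nbhs t),
    `|f (rho X t) - f s - d * (rho X t - s)| <= e * `|rho X t - s|.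

(* The value is 0 when f is not differentiable at t. *)
Definition delta_deriv X f t : R := xget 0 [set d | is_delta_deriv X f t d].

Definition nabla_deriv X f t : R := xget 0 [set d | is_nabla_deriv X f t d].

Definition is_delta_antideriv X f F :=
  forall t, upper_kappa X t -> is_delta_deriv X F t (f t).

Definition is_nabla_antideriv X f F :=
  forall t, lower_kappa X t -> is_nabla_deriv X F t (f t).

(* Cauchy delta and nabla integrals, F s - F r for any antiderivative F of f;
   the value is 0 when f has no antiderivative, which does not happen for
   rd-continuous (resp. ld-continuous) f. *)
Definition delta_integral X f r s : R :=
  xget 0 [set v | exists2 F, is_delta_antideriv X f F & v = F s - F r].

Definition nabla_integral X f r s : R :=
  xget 0 [set v | exists2 F, is_nabla_antideriv X f F & v = F s - F r].

Definition C1_diamond X y :=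
  [/\ forall t, upper_kappa X t -> exists d, is_delta_deriv X y t d,
      {within upper_kappa X, continuous (delta_deriv X y)},
      forall t, lower_kappa X t -> exists d, is_nabla_deriv X y t d &
      {within lower_kappa X, continuous (nabla_deriv X y)}].

End TimeScale.

Section Lagrangian.
Context {R : realType}.
Implicit Types (X T : set R) (L : R -> R -> R -> R) (y : R -> R) (t u v : R).

Definition partial2 L t u v : R := derive1 (fun x => L t x v) u.

Definition partial3 L t u v : R := derive1 (fun x => L t u x) v.

(* G(t, y^sigma(t), y^Delta(t)) and G(t, y^rho(t), y^nabla(t)), for G a
   Lagrangian or one of its partial derivatives. *)
Definition at_delta X L y t : R := L t (y (sigma X t)) (delta_deriv X y t).

Definition at_nabla X L y t : R := L t (y (rho X t)) (nabla_deriv X y t).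

Definition continuous_lagrangian T L :=
  {within [set p : R * (R * R) | T p.1],
    continuous (fun p : R * (R * R) => L p.1 p.2.1 p.2.2)}.

(* Smoothness in the sense of the calculus of variations on time scales: L and
   its first-order partial derivatives in the last two variables exist and are
   jointly continuous on T x R^2. *)
Definition smooth_lagrangian T L :=
  [/\ continuous_lagrangian T L,
      forall t u v, T t -> derivable (fun x => L t x v) u 1 /\
                           derivable (fun x => L t u x) v 1,
      continuous_lagrangian T (partial2 L) &
      continuous_lagrangian T (partial3 L)].

Definition jointly_convex X L := forall t, X t ->
  @convex_function R (R^o * R^o)%type setT (fun p => L t p.1 p.2).

Definition jointly_concave X L := forall t, X t ->
  @convex_function R (R^o * R^o)%type setT (fun p => - L t p.1 p.2).

Definition delta_nabla_functional X (a b g1 g2 : R) Ld Ln y : R :=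
  g1 * delta_integral X (at_delta X Ld y) a b +
  g2 * nabla_integral X (at_nabla X Ln y) a b.

(* At each t, the left-hand side of the delta-nabla Euler-Lagrange equation is
   g1 * EL_delta + g2 * EL_nabla, with one of the two terms evaluated at rho t
   or sigma t. *)
Definition EL_delta X (a : R) L y t : R :=
  at_delta X (partial3 L) y t -
  delta_integral X (at_delta X (partial2 L) y) a t.

Definition EL_nabla X (a : R) L y t : R :=
  at_nabla X (partial3 L) y t -
  nabla_integral X (at_nabla X (partial2 L) y) a t.

End Lagrangian.

(* Main.v *)
Require Import Defs.
From HB Require Import structures.
From mathcomp Require Import all_boot all_order all_algebra.
From mathcomp Require Import all_classical all_reals all_analysis.
From mathcomp Require Import ring lra.

Set Implicit Arguments.
Unset Strict Implicit.
Unset Printing Implicit Defensive.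

Import Order.TTheory GRing.Theory Num.Theory.
Import numFieldNormedType.Exports.

Local Open Scope classical_set_scope.
Local Open Scope ring_scope.

(** Convexity in the last two variables gives the gradient inequality
    L(t,u',v') >= L(t,u,v) + d2 L(t,u,v) (u'-u) + d3 L(t,u,v) (v'-v).  With
    h = y - yhat, integrate it along (yhat, y) and integrate the d2 term by
    parts: since h vanishes at both ends, the difference of the functionals is
    at least

      int p(t) h^Delta(t) Delta t + int q(t) h^nabla(t) nabla t,

    p and q being the weighted delta and nabla Euler-Lagrange expressions of
    yhat ([delta_variation], [nabla_variation]).  It remains to see that this
    sum vanishes when p(rho t) + q(t) is a constant c.

    Let Q be a nabla antiderivative of q h^nabla and G = c h - Q.  By the
    equation, G^nabla(t) = p(rho t) h^nabla(t), and formally this is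
    (p h^Delta)(rho t), because h^nabla = h^Delta o rho for a function of class
    C^1_diamond.  So G ought to be a delta antiderivative of p h^Delta, and then
    the sum is G(b) - G(a) + Q(b) - Q(a) = c (h(b) - h(a)) = 0.  The direction
    of this transfer matters.  The function p contains yhat^sigma, which is
    discontinuous at a left-dense right-scattered point, so a delta
    antiderivative of p h^Delta need not have the expected nabla derivative
    there.  Going from nabla to delta ([nabla_to_delta]) one needs continuity of
    p at right-dense points only, and that is what composition with sigma
    preserves.  The relation between the two derivatives of h is itself an instance
    of this transfer, in the form h^Delta = h^nabla o sigma.  The argument is
    carried out in [mixed_variation_ge0].

    The reflection t -> -t exchanges the delta and nabla calculi and the two
    forms of the Euler-Lagrange equation.  The mean value inequality, the
    existence of antiderivatives and the inequality above are therefore proved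
    on one side and reflected.  The rules of differentiation are proved once
    for an arbitrary jump function.

    Existence of antiderivatives cannot be skipped: an integral without
    antiderivative would be 0 by convention.  It is obtained from upper Darboux
    sums ([delta_antideriv_exists]) for integrands that are bounded and
    continuous at right-dense points ([regular]), a class that contains the
    integrands L(t, y^sigma, y^Delta) ([lagrangian_regular]). *)

(** * Derivatives with respect to a jump function *)

Section JumpDerivative.
Context {R : realType}.
Implicit Types (X K : set R) (j f g : R -> R) (t s d : R).

(** The delta and nabla derivatives are the instances where j is the forward and
    the backward jump; the rules below hold for any j. *)
Definition jump_deriv X j f t d :=
  forall e : R, 0 < e -> \forall s \near within X (nbhs t),
    `|f (j t) - f s - d * (j t - s)| <= e * `|j t - s|.

Lemma near_within_ballP X t (P : R -> Prop) :
  (\forall s \near within X (nbhs t), P s) <->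
  exists2 r, 0 < r & forall s, X s -> `|s - t| < r -> P s.
Proof.
rewrite near_withinE; split.
  move=> /nbhs_ballP[r r0 H]; exists r => // s Xs sr.
  by apply: H => //; rewrite /ball /= distrC.
move=> [r r0 H]; apply/nbhs_ballP; exists r => // s; rewrite /ball /= => sr Xs.
by apply: H => //; rewrite distrC.
Qed.

(** The increment of f over the jump is exact, since s = t is admissible in the
    definition for every e. *)
Lemma jump_deriv_base X j f t d : X t -> jump_deriv X j f t d ->
  f (j t) - f t = d * (j t - t).
Proof.
move=> Xt H; apply/eqP; rewrite -subr_eq0 -normr_le0.
apply/ler_addgt0Pl => e e0; rewrite addr0.
have c0 : 0 < `|j t - t| + 1 by rewrite ltr_wpDl.
have /near_within_ballP[r r0 /(_ t Xt)] := H _ (divr_gt0 e0 c0).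
rewrite subrr normr0 => /(_ r0) /le_trans; apply.
by rewrite mulrAC ler_pdivrMr// ler_pM2l// lerDl.
Qed.

Lemma jump_deriv_cts X j f t d : X t -> jump_deriv X j f t d ->
  f x @[x --> within X (nbhs t)] --> f t.
Proof.
move=> Xt H; apply/cvgrPdist_le => e e0.
set c := `|d| + `|j t - t| + 2.
have c0 : 0 < c by rewrite /c ltr_wpDl ?addr_ge0.
have ec0 := divr_gt0 e0 c0.
have /near_within_ballP[r r0 Hr] := H _ ec0.
apply/near_within_ballP; exists (Num.min (e / c) (Num.min 1 r)).
  by rewrite !lt_min ec0 r0 ltr01.
move=> s Xs; rewrite !lt_min => /and3P[se s1 sr].
have {Hr} := Hr s Xs sr.
have E := jump_deriv_base Xt H.
rewrite [f (j t) - f s](_ : _ = f t - f s + d * (j t - t)); last first.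
  by rewrite -E; ring.
rewrite [X in `|X|](_ : _ = f t - f s - d * (t - s)); last by ring.
move=> Hr.
have B : `|f t - f s| <= e / c * `|j t - s| + `|d| * `|s - t|.
  rewrite -[f t - f s](subrK (d * (t - s))).
  by rewrite (le_trans (ler_normD _ _))// normrM [`|t - s|]distrC lerD.
have J : `|j t - s| <= `|j t - t| + 1.
  rewrite -[j t - s](subrKA t) (le_trans (ler_normD _ _))// lerD2l distrC ltW//.
apply: (le_trans B).
rewrite [leRHS](_ : _ = e / c * (`|j t - t| + 1) + e / c * `|d| + e / c); last first.
  by rewrite -[LHS](@divfK _ c) ?gt_eqF// {2}/c; ring.
apply: le_trans (_ : e / c * (`|j t - t| + 1) + e / c * `|d| <= _).
  apply: lerD; first by rewrite ler_pM2l.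
  by rewrite mulrC ler_wpM2r// ltW.
by rewrite lerDl ltW.
Qed.

Lemma jump_deriv_loose X j f t d (C : R) : 0 < C ->
  (forall e, 0 < e -> \forall s \near within X (nbhs t),
    `|f (j t) - f s - d * (j t - s)| <= C * e * `|j t - s|) ->
  jump_deriv X j f t d.
Proof.
move=> C0 H e e0; have := H (e / C) (divr_gt0 e0 C0).
by rewrite mulrCA divff ?mulr1// gt_eqF.
Qed.

Lemma jump_derivD X j f g t d d' :
  jump_deriv X j f t d -> jump_deriv X j g t d' ->
  jump_deriv X j (fun s => f s + g s) t (d + d').
Proof.
move=> Hf Hg; apply: (@jump_deriv_loose _ _ _ _ _ 2) => // e e0.
near=> s.
rewrite [X in `|X|](_ : _ = (f (j t) - f s - d * (j t - s)) +
   (g (j t) - g s - d' * (j t - s))); last by ring.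
rewrite (le_trans (ler_normD _ _))// -mulrA mulr2n mulrDl mul1r.
by apply: lerD; near: s; [exact: Hf|exact: Hg].
Unshelve. all: by end_near. Qed.

(** This is (f g)^Delta = f^Delta g^sigma + f g^Delta, the form in which
    integration by parts produces the jump of the second factor. *)
Lemma jump_derivM X j f g t d d' : X t ->
  jump_deriv X j f t d -> jump_deriv X j g t d' ->
  jump_deriv X j (fun s => f s * g s) t (d * g (j t) + f t * d').
Proof.
move=> Xt Hf Hg.
apply: (@jump_deriv_loose _ _ _ _ _ (`|g (j t)| + `|f t| + 1 + `|d'|)) => [|e e0].
  by rewrite ltr_wpDr// ltr_wpDl// addr_ge0.
near=> s.
rewrite [X in `|X|](_ : _ = (f (j t) - f s - d * (j t - s)) * g (j t) +
   f s * (g (j t) - g s - d' * (j t - s)) + (f s - f t) * d' * (j t - s)); last by ring.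
have fs : `|f t - f s| <= Num.min 1 e.
  near: s; apply: (@cvgr_dist_le _ _ _ _ _ f); last by rewrite lt_min ltr01.
  exact: jump_deriv_cts Hf.
move: fs; rewrite le_min distrC => /andP[fs1 fse].
have fs2 : `|f s| <= `|f t| + 1.
  by rewrite -[f s](subrK (f t)) (le_trans (ler_normD _ _))// addrC lerD2l.
have F1 : `|f (j t) - f s - d * (j t - s)| <= e * `|j t - s|.
  by near: s; exact: Hf.
have F2 : `|g (j t) - g s - d' * (j t - s)| <= e * `|j t - s|.
  by near: s; exact: Hg.
rewrite [leRHS](_ : _ = (e * `|j t - s|) * `|g (j t)| + (`|f t| + 1) * (e * `|j t - s|)
  + e * `|d'| * `|j t - s|); last by ring.
rewrite (le_trans (ler_normD _ _))// lerD// ?(le_trans (ler_normD _ _))// ?lerD//.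
- by rewrite normrM ler_wpM2r.
- by rewrite normrM ler_pM.
- by rewrite !normrM ler_wpM2r// ler_wpM2r.
Unshelve. all: by end_near. Qed.

Lemma jump_deriv_cst X j (c : R) t : jump_deriv X j (fun=> c) t 0.
Proof.
move=> e e0; near=> s.
by rewrite mul0r subrr subr0 normr0 mulr_ge0// ltW.
Unshelve. all: by end_near. Qed.

Lemma jump_derivZ X j (c : R) f t d : X t ->
  jump_deriv X j f t d -> jump_deriv X j (fun s => c * f s) t (c * d).
Proof.
move=> Xt Hf; have := jump_derivM Xt (jump_deriv_cst X j c t) Hf.
by rewrite mul0r add0r.
Qed.

Lemma jump_derivB X j f g t d d' : X t ->
  jump_deriv X j f t d -> jump_deriv X j g t d' ->
  jump_deriv X j (fun s => f s - g s) t (d - d').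
Proof.
move=> Xt Hf Hg; have := jump_derivD Hf (jump_derivZ (-1) Xt Hg).
rewrite mulN1r; rewrite (_ : (fun s => f s + -1 * g s) = fun s => f s - g s)//.
by apply/funext => s; rewrite mulN1r.
Qed.

(** At a scattered point |j t - s| stays away from 0 near t, so continuity controls
    everything but the jump itself. *)
Lemma jump_deriv_scattered X j f t d : j t != t ->
  f x @[x --> within X (nbhs t)] --> f t ->
  f (j t) - f t = d * (j t - t) -> jump_deriv X j f t d.
Proof.
move=> jt ft E e e0.
have m0 : 0 < `|j t - t| / 2 by rewrite divr_gt0// normr_gt0 subr_eq0.
set c := `|d| + 1.
have c0 : 0 < c by rewrite /c ltr_wpDl.
have /near_within_ballP[r r0 Hr] :
   \forall s \near within X (nbhs t), `|f t - f s| <= e / 2 * (`|j t - t| / 2).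
  by apply: (@cvgr_dist_le _ _ _ _ _ f) => //; rewrite mulr_gt0// divr_gt0.
apply/near_within_ballP.
exists (Num.min r (Num.min (`|j t - t| / 2) (e / 2 * (`|j t - t| / 2) / c))).
  by rewrite !lt_min r0 m0 /= divr_gt0// mulr_gt0// divr_gt0.
move=> s Xs; rewrite !lt_min => /and3P[sr sm sc].
rewrite [X in `|X|](_ : _ = (f t - f s) + d * (s - t)); last first.
  by rewrite -[f (j t)](subrK (f t)) E; ring.
have J : `|j t - t| / 2 <= `|j t - s|.
  have : `|j t - t| <= `|j t - s| + `|s - t|.
    by rewrite -[j t - t](subrKA s) ler_normD.
  by lra.
apply: le_trans (_ : e * (`|j t - t| / 2) <= _); last by rewrite ler_pM2l.
rewrite (le_trans (ler_normD _ _))// [e in leRHS]splitr mulrDl lerD//; first exact: Hr.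
rewrite normrM; apply: le_trans (_ : c * `|s - t| <= _).
  by rewrite ler_wpM2r// /c lerDl.
by rewrite mulrC -ler_pdivlMr// ltW.
Qed.

(** The mean value inequality delivers increments between ordered points around t;
    at a dense point these determine the derivative. *)
Lemma jump_deriv_dense X j f t d : X t -> j t = t ->
  (forall e, 0 < e -> exists2 r, 0 < r & forall u v, X u -> X v -> u <= v ->
     `|u - t| < r -> `|v - t| < r ->
     `|f v - f u - d * (v - u)| <= e * (v - u)) ->
  jump_deriv X j f t d.
Proof.
move=> Xt jt H e e0; have [r r0 {}H] := H e e0.
apply/near_within_ballP; exists r => // s Xs sr; rewrite jt.
have [st|ts] := leP s t.
  by rewrite [`|t - s|]ger0_norm ?subr_ge0//; apply: H => //; rewrite subrr normr0.
rewrite -normrN [X in `|X|](_ : _ = f s - f t - d * (s - t)); last by ring.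
rewrite [`|t - s|]ltr0_norm ?subr_lt0// opprB.
by apply: H => //; rewrite ?subrr ?normr0// ltW.
Qed.

(** At a fixed point of j the limit defining the derivative has to see some s <> t. *)
Lemma jump_deriv_unique X j f t d d' : X t ->
  (j t = t -> forall r, 0 < r -> exists2 s, X s & s != t /\ `|s - t| < r) ->
  jump_deriv X j f t d -> jump_deriv X j f t d' -> d = d'.
Proof.
move=> Xt L H H'; have [jt|jt] := eqVneq (j t) t; last first.
  apply: (mulIf (x := j t - t)); first by rewrite subr_eq0.
  by rewrite -(jump_deriv_base Xt H) (jump_deriv_base Xt H').
apply/eqP; rewrite -subr_eq0 -normr_le0.
apply/ler_addgt0Pl => e e0; rewrite addr0.
have e20 : 0 < e / 2 by rewrite divr_gt0.
have /near_within_ballP[r r0 Hr] := H _ e20.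
have /near_within_ballP[r' r'0 Hr'] := H' _ e20.
have [|s Xs [st]] := L jt (Num.min r r'); first by rewrite lt_min r0.
rewrite lt_min => /andP[sr sr'].
have := Hr s Xs sr; have := Hr' s Xs sr'; rewrite jt => A B.
have p0 : 0 < `|t - s| by rewrite normr_gt0 subr_eq0 eq_sym.
rewrite -(ler_pM2r p0) -normrM.
rewrite [X in `|X|](_ : _ = (f t - f s - d' * (t - s)) - (f t - f s - d * (t - s))); last by ring.
by rewrite (le_trans (ler_normB _ _))// [e in leRHS]splitr mulrDl lerD.
Qed.

End JumpDerivative.

(** * Reflection *)

Section Reflection.
Context {R : realType}.
Implicit Types (X K : set R) (j f F : R -> R) (t d : R).

Definition refl X : set R := [set t | X (- t)].

Lemma reflK X : refl (refl X) = X.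
Proof. by apply/seteqP; split => t; rewrite /refl /= opprK. Qed.

Lemma refl_image X : refl X = -%R @` X.
Proof.
apply/seteqP; split => t; rewrite /refl /=; last by move=> [s Xs <-]; rewrite opprK.
by move=> Xt; exists (- t) => //; rewrite opprK.
Qed.

Lemma inf_reflE X : inf X = - sup (refl X).
Proof. by rewrite refl_image. Qed.

(** This identity carries the whole symmetry: jumps, kappa sets and derivatives are
    exchanged by reflection as a consequence. *)
Lemma sigma_refl X t : sigma (refl X) t = - rho X (- t).
Proof.
rewrite /sigma /rho.
have -> : [set s | refl X s /\ t < s] = refl [set s | X s /\ s < - t].
  by apply/seteqP; split => s; rewrite /refl /= ltrN2.
rewrite inf_reflE reflK.
have -> : `[< exists2 s, refl X s & t < s >] = `[< exists2 s, X s & s < - t >].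
  apply: asbool_equiv_eq; split=> -[s Xs H]; exists (- s) => //; rewrite /refl /= ?opprK//.
    by rewrite ltrN2.
  by rewrite ltrNr.
by case: asboolP => _; rewrite ?opprK.
Qed.

Lemma rho_refl X t : rho (refl X) t = - sigma X (- t).
Proof. by rewrite -{2}[X]reflK sigma_refl !opprK. Qed.

Lemma upper_kappa_refl X : upper_kappa (refl X) = refl (lower_kappa X).
Proof.
have E : sup (refl X) = - inf X by rewrite inf_reflE opprK.
rewrite /upper_kappa E rho_refl opprK /lower_kappa.
apply/seteqP; split => t [Xt N]; split => // H; apply: N; move: H; rewrite /= !in_itv /=; lra.
Qed.

Lemma lower_kappa_refl X : lower_kappa (refl X) = refl (upper_kappa X).
Proof. by rewrite -{2}[X]reflK upper_kappa_refl reflK. Qed.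

Lemma near_within_refl X t (P : R -> Prop) :
  (\forall s \near within X (nbhs t), P s) ->
  \forall s \near within (refl X) (nbhs (- t)), P (- s).
Proof.
move=> /near_within_ballP[r r0 H]; apply/near_within_ballP; exists r => // s Xs.
by rewrite opprK => sr; apply: H => //; rewrite -normrN opprB opprK addrC.
Qed.

Lemma cvg_refl X f t : f x @[x --> within X (nbhs t)] --> f t ->
  f (- x) @[x --> within (refl X) (nbhs (- t))] --> f (- - t).
Proof.
rewrite opprK => /cvgrPdist_le H; apply/cvgrPdist_le => e e0.
exact: (near_within_refl (H e e0)).
Qed.

Lemma jump_deriv_refl X j f t d : jump_deriv X j f t d ->
  jump_deriv (refl X) (fun s => - j (- s)) (fun s => - f (- s)) (- t) d.
Proof.
move=> H e e0; apply: filterS (near_within_refl (H e e0)) => s.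
rewrite !opprK => H'.
rewrite (_ : - f (j t) + _ - _ = - (f (j t) - f (- s) - d * (j t + s))); last by ring.
by rewrite (_ : - j t - s = - (j t + s)) ?normrN//; ring.
Qed.

(** The sign on the antiderivative compensates the reversal of time, so that the
    derivative is reflected without a sign. *)
Lemma delta_antideriv_refl X f F : is_nabla_antideriv X f F ->
  is_delta_antideriv (refl X) (fun t => f (- t)) (fun t => - F (- t)).
Proof.
move=> H t; rewrite upper_kappa_refl => /H /jump_deriv_refl.
rewrite opprK (_ : (fun s => - rho X (- s)) = sigma (refl X))//.
by apply/funext => s; rewrite sigma_refl.
Qed.

Lemma nabla_antideriv_refl X f F : is_delta_antideriv X f F ->
  is_nabla_antideriv (refl X) (fun t => f (- t)) (fun t => - F (- t)).
Proof.
move=> H t; rewrite lower_kappa_refl => /H /jump_deriv_refl.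
rewrite opprK (_ : (fun s => - sigma X (- s)) = rho (refl X))//.
by apply/funext => s; rewrite rho_refl.
Qed.

End Reflection.

(** * Jumps on a compact time scale *)

Section CompactScale.
Context {R : realType}.
Implicit Types (X : set R) (f F : R -> R) (a b r s t d m e : R).

Definition compact_scale X a b :=
  [/\ closed X, X a, X b & forall t, X t -> a <= t <= b].

Lemma closed_limit X t : closed X ->
  (forall e, 0 < e -> exists2 s, X s & `|s - t| < e) -> X t.
Proof.
move=> cX H; apply: cX => B /nbhs_ballP[e /= e0 Be].
have [s Xs st] := H e e0; exists s; split => //.
by apply: Be; rewrite /ball /= distrC.
Qed.

Lemma compact_scale_refl X a b : compact_scale X a b -> compact_scale (refl X) (- b) (- a).
Proof.
move=> [cX Xa Xb Xab]; split; rewrite /refl /= ?opprK//.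
- move=> t Ht; apply: (closed_limit cX) => e e0.
  have [|s [Xs]] := Ht (ball t e); first exact: nbhsx_ballx.
  rewrite /ball /= => ts; exists (- s) => //.
  by rewrite opprK addrC.
- by move=> t /Xab; lra.
Qed.

Lemma sigma_ge X t : t <= sigma X t.
Proof.
rewrite /sigma; case: asboolP => // -[s Xs ts].
by apply: lb_le_inf; [exists s|move=> u [_ /ltW]].
Qed.

Lemma sigma_le X t s : X s -> t < s -> sigma X t <= s.
Proof.
move=> Xs ts; rewrite /sigma; case: asboolP => [_|N]; last exact: ltW.
by apply: ge_inf => //; exists t => u [_ /ltW].
Qed.

Lemma sigma_adherent X t e : (exists2 s, X s & t < s) -> 0 < e ->
  exists2 s, X s & t < s < sigma X t + e.
Proof.
move=> H e0; rewrite /sigma; case: asboolP => // _.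
case: H => s Xs ts.
have /(inf_adherent e0)[u [Xu tu] ue] : has_inf [set s | X s /\ t < s].
  by split; [exists s|exists t => u [_ /ltW]].
by exists u => //; rewrite tu.
Qed.

Section Facts.
Context (X : set R) (a b : R) (sX : compact_scale X a b).

Lemma scale_ge t : X t -> a <= t.
Proof. by case: sX => _ _ _ H /H/andP[]. Qed.

Lemma scale_le t : X t -> t <= b.
Proof. by case: sX => _ _ _ H /H/andP[]. Qed.

Lemma sigma_in t : X t -> X (sigma X t).
Proof.
move=> Xt; have [H|N] := pselect (exists2 s, X s & t < s); last first.
  by rewrite /sigma; case: asboolP.
case: sX => cX _ _ _; apply: closed_limit => // e e0.
have [s Xs /andP[ts se]] := sigma_adherent H e0; exists s => //.
by rewrite ger0_norm ?subr_ge0 ?sigma_le// ltrBlDl.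
Qed.

Lemma sigma_dense t e : X t -> t < b -> sigma X t = t -> 0 < e ->
  exists2 s, X s & t < s < t + e.
Proof.
move=> Xt tb st e0; rewrite -{2}st; apply: sigma_adherent => //.
by exists b => //; case: sX.
Qed.

Lemma sup_scale : sup X = b.
Proof.
case: sX => _ _ Xb _; apply/eqP; rewrite eq_le; apply/andP; split.
  by apply: ge_sup; [exists b|exact: scale_le].
by apply: ub_le_sup => //; exists b; exact: scale_le.
Qed.

Lemma upper_kappaP t : upper_kappa X t <-> X t /\ t <= rho X b.
Proof.
rewrite /upper_kappa sup_scale; split=> [[Xt /=]|[Xt tb]].
  rewrite in_itv /= (scale_le Xt) andbT => /negP; rewrite -leNgt.
  by split.
by split => //=; rewrite in_itv /= ltNge tb.
Qed.

Lemma upper_kappa_sub t : upper_kappa X t -> X t.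
Proof. by case. Qed.

End Facts.

Lemma rho_le X t : rho X t <= t.
Proof. by rewrite -lerN2 -[t in rho X t]opprK -sigma_refl sigma_ge. Qed.

Lemma rho_ge X t s : X s -> s < t -> s <= rho X t.
Proof.
move=> Xs st; rewrite -lerN2 -[t in rho X t]opprK -sigma_refl sigma_le//.
  by rewrite /refl /= opprK.
by rewrite ltrN2.
Qed.

Lemma rho_in X a b t : compact_scale X a b -> X t -> X (rho X t).
Proof.
move=> /compact_scale_refl sX Xt; rewrite -[t]opprK -[rho _ _]opprK -sigma_refl.
by apply: (sigma_in sX); rewrite /refl /= opprK.
Qed.

Lemma rho_dense X a b t e : compact_scale X a b -> X t -> a < t -> rho X t = t -> 0 < e ->
  exists2 s, X s & t - e < s < t.
Proof.
move=> /compact_scale_refl sX Xt at_ rt e0.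
have [|||s Xs H] := sigma_dense sX (t := - t) _ _ _ e0.
- by rewrite /refl /= opprK.
- by rewrite ltrN2.
- by rewrite sigma_refl opprK rt.
- by exists (- s) => //; lra.
Qed.

Lemma lower_kappaP X a b t : compact_scale X a b -> lower_kappa X t <-> X t /\ sigma X a <= t.
Proof.
move=> /compact_scale_refl sX.
rewrite -[X in lower_kappa X]reflK lower_kappa_refl /refl /= (upper_kappaP sX).
by rewrite rho_refl opprK /refl /= opprK lerN2.
Qed.

(** Otherwise sigma t would be left-dense, and X would have points strictly between
    t and sigma t. *)
Lemma rho_sigma X a b t : compact_scale X a b -> X t -> t < sigma X t -> rho X (sigma X t) = t.
Proof.
move=> sX Xt ts; have Xst := sigma_in sX Xt.
apply/eqP; rewrite eq_le (rho_ge Xt ts) andbT leNgt; apply/negP => H.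
have rin := rho_in sX Xst.
have r_eq : rho X (sigma X t) = sigma X t.
  by apply/eqP; rewrite eq_le rho_le (sigma_le rin).
have st0 : 0 < sigma X t - t by rewrite subr_gt0.
have [|s Xs /andP[]] := rho_dense sX Xst _ r_eq st0.
  by rewrite (le_lt_trans (scale_ge sX Xt)).
rewrite opprB addrC subrK => /(sigma_le Xs) st /lt_le_trans/(_ st).
by rewrite ltxx.
Qed.

Lemma lt_upper_kappa X a b t : compact_scale X a b -> X t -> t < b -> upper_kappa X t.
Proof. by move=> sX Xt tb; apply/(upper_kappaP sX); split => //; exact: rho_ge. Qed.

Lemma gt_lower_kappa X a b t : compact_scale X a b -> X t -> a < t -> lower_kappa X t.
Proof. by move=> sX Xt tb; apply/(lower_kappaP _ sX); split => //; exact: sigma_le. Qed.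

(** The maximum b is a fixed point of sigma without being right-dense, but it lies in
    the upper kappa set only when it is left-dense. *)
Lemma upper_kappa_limit X a b t e : compact_scale X a b -> a < b -> upper_kappa X t ->
  sigma X t = t -> 0 < e -> exists2 s, X s & s != t /\ `|s - t| < e.
Proof.
move=> sX ab /(upper_kappaP sX)[Xt tb] st e0.
have [tb'|bt] := ltP t b.
  have [s Xs H] := sigma_dense sX Xt tb' st e0.
  by exists s => //; split; [rewrite gt_eqF//; lra|rewrite gtr0_norm; lra].
have {bt} bt : t = b by apply/eqP; rewrite eq_le bt (scale_le sX Xt).
subst t; have rb : rho X b = b by apply/eqP; rewrite eq_le rho_le tb.
have [s Xs H] := rho_dense sX Xt ab rb e0.
by exists s => //; split; [rewrite lt_eqF//; lra|rewrite ltr0_norm; lra].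
Qed.

(** From the left, s <= sigma s <= t; from the right, a point u of X close to t
    bounds sigma s for all s < u. *)
Lemma sigma_cvg X a b t : compact_scale X a b -> X t -> sigma X t = t ->
  sigma X s @[s --> within X (nbhs t)] --> t.
Proof.
move=> sX Xt st; apply/cvgrPdist_le => e e0; apply/near_within_ballP.
have [d d0 Hd] : exists2 d, 0 < d & forall s, X s -> s < t + d -> sigma X s <= t + e.
  have [tb|bt] := ltP t b; last first.
    exists 1 => // s Xs _; rewrite (le_trans (scale_le sX (sigma_in sX Xs)))//.
    by rewrite (le_trans bt)// lerDl ltW.
  have [u Xu /andP[tu ue]] := sigma_dense sX Xt tb st e0.
  exists (u - t); first by rewrite subr_gt0.
  by move=> s Xs; rewrite addrC subrK => /(sigma_le Xu) /le_trans; apply; rewrite ltW.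
exists (Num.min d e); first by rewrite lt_min d0.
move=> s Xs; rewrite lt_min => /andP[sd se].
have := sigma_ge X s; have := Hd s Xs.
move: sd se; rewrite !ltr_norml ler_norml => /andP[s1 s2] /andP[s3 s4].
have -> : s < t + d by lra.
by move=> /(_ isT) H1 H2; lra.
Qed.

Lemma rho_cvg X a b t : compact_scale X a b -> X t -> rho X t = t ->
  rho X s @[s --> within X (nbhs t)] --> t.
Proof.
move=> /compact_scale_refl sX Xt rt.
have Xt' : refl X (- t) by rewrite /refl /= opprK.
have st : sigma (refl X) (- t) = - t by rewrite sigma_refl opprK rt.
have /cvgrPdist_le H := sigma_cvg sX Xt' st.
apply/cvgrPdist_le => e e0; have := near_within_refl (H e e0).
rewrite reflK opprK; apply: filterS => s.
by rewrite sigma_refl !opprK -normrN opprD opprK.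
Qed.

Lemma compact_scale_compact X a b : compact_scale X a b -> compact X.
Proof.
move=> sX; apply: (subclosed_compact _ (@segment_compact R a b)); first by case: sX.
by move=> t Xt /=; rewrite in_itv /= (scale_ge sX Xt) (scale_le sX Xt).
Qed.

Lemma compact_upper_kappa X a b : compact_scale X a b -> compact (upper_kappa X).
Proof.
move=> sX; apply: (subclosed_compact _ (compact_scale_compact sX)); last exact: upper_kappa_sub.
rewrite (_ : upper_kappa X = X `&` [set t | t <= rho X b]).
  by apply: closedI; [case: sX|exact: closed_le].
by apply/seteqP; split => t /(upper_kappaP sX).
Qed.

Lemma compact_lower_kappa X a b : compact_scale X a b -> compact (lower_kappa X).
Proof.
move=> sX; apply: (subclosed_compact _ (compact_scale_compact sX)); last by move=> t [].
rewrite (_ : lower_kappa X = X `&` [set t | sigma X a <= t]).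
  by apply: closedI; [case: sX|exact: closed_ge].
by apply/seteqP; split => t /(lower_kappaP _ sX).
Qed.

Lemma rho_upper_kappa X a b t : compact_scale X a b -> X t -> upper_kappa X (rho X t).
Proof.
move=> sX Xt; apply/(upper_kappaP sX); split; first exact: (rho_in sX).
have := scale_le sX Xt; rewrite le_eqVlt => /orP[/eqP ->//|tb].
exact: le_trans (rho_le X t) (rho_ge Xt tb).
Qed.

Lemma dense_lower_kappa X a b t : compact_scale X a b -> X t -> sigma X t = t -> lower_kappa X t.
Proof.
move=> sX Xt st; have := scale_ge sX Xt; rewrite le_eqVlt => /orP[/eqP E|].
  apply/(lower_kappaP _ sX); split => //.
  by rewrite E st.
exact: (gt_lower_kappa sX).
Qed.

End CompactScale.

(** * Mean value inequality *)

Section MeanValue.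
Context {R : realType}.
Implicit Types (X : set R) (f g F G : R -> R) (a b r s t d m e : R).

(** Outside the upper kappa set there is at most b, which is then isolated. *)
Lemma delta_antideriv_cts X a b f F t : compact_scale X a b ->
  is_delta_antideriv X f F -> X t -> F x @[x --> within X (nbhs t)] --> F t.
Proof.
move=> sX H Xt; have [tb|bt] := ltP t b.
  exact: (jump_deriv_cts Xt (H _ (lt_upper_kappa sX Xt tb))).
have {bt} bt : t = b by apply/eqP; rewrite eq_le bt (scale_le sX Xt).
subst t; have [/eqP rb|rb] := boolP (rho X b == b).
  by apply: (jump_deriv_cts Xt (H _ _)); apply/(upper_kappaP sX); rewrite rb.
have {}rb : rho X b < b by rewrite lt_neqAle rb rho_le.
apply/cvgrPdist_le => e e0; apply/near_within_ballP.
exists (b - rho X b); first by rewrite subr_gt0.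
move=> s Xs; rewrite ltr_norml => /andP[s1 _].
suff -> : s = b by rewrite subrr normr0 ltW.
apply/eqP; rewrite eq_le (scale_le sX Xs) leNgt; apply/negP => /(rho_ge Xs); lra.
Qed.

(** The supremum c of the points x at which the increment from r is at least
    (m - e) (x - r) is attained by continuity. If c < s, the derivative at c allows
    one more step: to sigma c if c is right-scattered, to nearby points otherwise. *)
Lemma delta_mvt_ge X a b f F r s m : compact_scale X a b ->
  is_delta_antideriv X f F -> X r -> X s -> r <= s ->
  (forall t, X t -> r <= t -> t < s -> m <= f t) ->
  m * (s - r) <= F s - F r.
Proof.
move=> sX HF Xr Xs rs Hm.
have cF := delta_antideriv_cts sX HF.
(* The slack e absorbs the error term of the derivative at right-dense points. *)
suff W e : 0 < e -> F r + (m - e) * (s - r) <= F s.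
  apply/ler_addgt0Pl => e e0.
  have c0 : 0 < s - r + 1 by rewrite ltr_wpDl// subr_ge0.
  have := W _ (divr_gt0 e0 c0).
  have : e / (s - r + 1) * (s - r) <= e.
    by rewrite mulrAC ler_pdivrMr// ler_pM2l// lerDl.
  by lra.
move=> e0.
pose E := [set x | [/\ X x, r <= x <= s & F r + (m - e) * (x - r) <= F x]].
have Er : E r by split; rewrite ?lexx ?rs// subrr mulr0 addr0.
have hE : has_sup E by split; [exists r|exists s => x [_ /andP[]]].
pose c := sup E.
have rc : r <= c by apply: ub_le_sup => //; case: hE.
have cs : c <= s by apply: ge_sup; [exists r|move=> x [_ /andP[]]].
have adhE d : 0 < d -> exists2 x, E x & c - d < x <= c.
  move=> d0; have [x Ex xd] := sup_adherent d0 hE; exists x => //.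
  by rewrite xd /=; apply: ub_le_sup => //; case: hE.
have Xc : X c.
  case: sX => cX _ _ _; apply: closed_limit => // d /adhE[x [Xx _ _] xc].
  by exists x => //; rewrite distrC ger0_norm; lra.
have Ec : E c.
  split; [by []|by rewrite rc|].
  rewrite leNgt; apply/negP => Fc.
  pose g x := F x - (m - e) * x.
  have cg : g x @[x --> within X (nbhs c)] --> g c.
    apply: cvgB; first exact: cF.
    by apply: cvgM; [exact: cvg_cst|exact: cvg_within].
  have /near_within_ballP[d d0 Hd] :
      \forall x \near within X (nbhs c), g x < F r - (m - e) * r.
    by apply: (cvgr_lt (g c)) => //; rewrite /g; lra.
  have [x [Xx _ Fx] xc] := adhE d d0.
  have : g x < F r - (m - e) * r by apply: Hd => //; rewrite distrC ger0_norm; lra.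
  by rewrite /g; lra.
case: (Ec) => _ _ Fc.
move: cs; rewrite le_eqVlt => /orP[/eqP <-//|cs].
exfalso.
have cb : c < b by rewrite (lt_le_trans cs)// (scale_le sX).
have Dc := HF c (lt_upper_kappa sX Xc cb).
have mf := Hm c Xc rc cs.
have noE x : c < x -> ~ E x.
  move=> cx Ex; have : x <= c by apply: ub_le_sup => //; case: hE.
  by rewrite leNgt cx.
have := sigma_ge X c; rewrite le_eqVlt => /orP[/eqP sc|sc].
  have /near_within_ballP[d d0 Hd] := Dc e e0.
  have d'0 : 0 < Num.min d (s - c) by rewrite lt_min d0 subr_gt0.
  have [u Xu] := sigma_dense sX Xc cb (esym sc) d'0.
  rewrite addrC -ltrBlDr lt_min => /andP[cu /andP[ud us]].
  apply: (noE u cu).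
  have rus : r <= u <= s by apply/andP; split; lra.
  split; [by []|by []|].
  have := Hd u Xu; rewrite -sc gtr0_norm ?subr_gt0// => /(_ ud).
  rewrite [`|c - u|]ltr0_norm ?subr_lt0// ler_norml => /andP[_ H].
  have : (m - f c) * (u - c) <= 0 by apply: mulr_le0_ge0; lra.
  by nra.
apply: (noE _ sc).
split; first exact: (sigma_in sX).
  by rewrite (sigma_le Xs cs) (le_trans rc (ltW sc)).
have := jump_deriv_base Xc Dc.
nra.
Qed.

Lemma delta_antiderivN X a b f F : compact_scale X a b -> is_delta_antideriv X f F ->
  is_delta_antideriv X (fun t => - f t) (fun t => - F t).
Proof.
move=> sX H t Kt; rewrite -mulN1r (_ : (fun t => - F t) = (fun t => -1 * F t)).
  by apply: jump_derivZ; [exact: upper_kappa_sub Kt|exact: H].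
by apply/funext => x; rewrite mulN1r.
Qed.

Lemma delta_mvt X a b f F r s d e : compact_scale X a b ->
  is_delta_antideriv X f F -> X r -> X s -> r <= s ->
  (forall t, X t -> r <= t -> t < s -> `|f t - d| <= e) ->
  `|F s - F r - d * (s - r)| <= e * (s - r).
Proof.
move=> sX HF Xr Xs rs H.
have A : (d - e) * (s - r) <= F s - F r.
  by apply: (delta_mvt_ge sX HF) => // t Xt rt ts; have := H t Xt rt ts; rewrite ler_norml; lra.
have B : (- d - e) * (s - r) <= - F s - - F r.
  apply: (delta_mvt_ge sX (delta_antiderivN sX HF)) => // t Xt rt ts.
  by have := H t Xt rt ts; rewrite ler_norml; lra.
by rewrite ler_norml; lra.
Qed.

Lemma nabla_mvt X a b f F r s d e : compact_scale X a b ->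
  is_nabla_antideriv X f F -> X r -> X s -> r <= s ->
  (forall t, X t -> r < t -> t <= s -> `|f t - d| <= e) ->
  `|F s - F r - d * (s - r)| <= e * (s - r).
Proof.
move=> sX HF Xr Xs rs H.
have := @delta_mvt _ _ _ _ _ (- s) (- r) d e (compact_scale_refl sX) (delta_antideriv_refl HF).
rewrite /refl /= !opprK lerN2 [- r + s]addrC [- F r + F s]addrC; apply => // t Xt st tr.
by apply: H => //; lra.
Qed.

Lemma delta_antideriv_le X a b f g F G : compact_scale X a b ->
  is_delta_antideriv X f F -> is_delta_antideriv X g G ->
  (forall t, upper_kappa X t -> f t <= g t) -> F b - F a <= G b - G a.
Proof.
move=> sX HF HG H; have [_ Xa Xb _] := sX.
have HD : is_delta_antideriv X (fun t => g t - f t) (fun t => G t - F t).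
  by move=> t Kt; apply: jump_derivB (HG t Kt) (HF t Kt); exact: upper_kappa_sub Kt.
have /(_ 0) := delta_mvt_ge sX HD Xa Xb (scale_le sX Xa).
rewrite mul0r => H'; suff : 0 <= G b - F b - (G a - F a) by lra.
apply: H' => t Xt _ tb; rewrite subr_ge0; apply: H; exact: (lt_upper_kappa sX).
Qed.

Lemma nabla_antideriv_le X a b f g F G : compact_scale X a b ->
  is_nabla_antideriv X f F -> is_nabla_antideriv X g G ->
  (forall t, lower_kappa X t -> f t <= g t) -> F b - F a <= G b - G a.
Proof.
move=> sX HF HG H.
have := delta_antideriv_le (compact_scale_refl sX) (delta_antideriv_refl HF) (delta_antideriv_refl HG).
rewrite !opprK upper_kappa_refl ![- _ + _]addrC; apply => t; exact: H.
Qed.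

(** By the mean value inequality with bound 0, two antiderivatives of f differ by a
    constant on X. *)
Lemma delta_integralE X a b f F t : compact_scale X a b -> is_delta_antideriv X f F -> X t ->
  delta_integral X f a t = F t - F a.
Proof.
move=> sX HF Xt; apply: xget_unique; first by exists F.
move=> _ [G HG ->]; have [_ Xa _ _] := sX.
have HD : is_delta_antideriv X (fun t => f t - f t) (fun t => G t - F t).
  by move=> s Ks; apply: jump_derivB (HG s Ks) (HF s Ks); exact: upper_kappa_sub Ks.
have := @delta_mvt _ _ _ _ _ a t 0 0 sX HD Xa Xt (scale_ge sX Xt).
rewrite !mul0r subr0 normr_le0 => H; apply/eqP; rewrite -subr_eq0.
rewrite (_ : G t - G a - _ = G t - F t - (G a - F a)); last by ring.
by apply: H => s _ _ _; rewrite subrr subr0 normr0.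
Qed.

Lemma nabla_integralE X a b f F t : compact_scale X a b -> is_nabla_antideriv X f F -> X t ->
  nabla_integral X f a t = F t - F a.
Proof.
move=> sX HF Xt; apply: xget_unique; first by exists F.
move=> _ [G HG ->]; have [_ Xa _ _] := sX.
have HD : is_nabla_antideriv X (fun t => f t - f t) (fun t => G t - F t).
  by move=> s Ks; apply: jump_derivB (HG s Ks) (HF s Ks); case: Ks.
have := @nabla_mvt _ _ _ _ _ a t 0 0 sX HD Xa Xt (scale_ge sX Xt).
rewrite !mul0r subr0 normr_le0 => H; apply/eqP; rewrite -subr_eq0.
rewrite (_ : G t - G a - _ = G t - F t - (G a - F a)); last by ring.
by apply: H => s _ _ _; rewrite subrr subr0 normr0.
Qed.

End MeanValue.

(** * Bounded functions that are continuous at dense points *)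

Section Regular.
Context {R : realType}.
Implicit Types (X K : set R) (j f g y v : R -> R) (L : R -> R -> R -> R) (t : R).

(** With j = sigma and K the upper kappa set, this is rd-continuity with the existence
    of left limits relaxed to boundedness, which is easier to check for
    L(t, y^sigma, y^Delta) and enough for integration. *)
Definition regular K j f :=
  (exists M, forall t, K t -> `|f t| <= M) /\
  (forall t, K t -> j t = t -> f x @[x --> within K (nbhs t)] --> f t).

Lemma regularD K j f g : regular K j f -> regular K j g ->
  regular K j (fun t => f t + g t).
Proof.
move=> [[M HM] cf] [[N HN] cg]; split.
  exists (M + N) => t Kt; rewrite (le_trans (ler_normD _ _))// lerD//.
    exact: HM.
  exact: HN.
by move=> t Kt jt; apply: cvgD; [exact: cf|exact: cg].
Qed.

Lemma regularM K j f g : regular K j f -> regular K j g ->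
  regular K j (fun t => f t * g t).
Proof.
move=> [[M HM] cf] [[N HN] cg]; split.
  by exists (M * N) => t Kt; rewrite normrM ler_pM ?HM ?HN.
by move=> t Kt jt; apply: cvgM; [exact: cf|exact: cg].
Qed.

Lemma regular_cst K j (c : R) : regular K j (fun=> c).
Proof. by split; first (by exists `|c|); move=> t _ _; exact: cvg_cst. Qed.

Lemma compact_bound (T : topologicalType) (A : set T) (f : T -> R) :
  compact A -> {within A, continuous f} -> exists M, forall x, A x -> `|f x| <= M.
Proof.
move=> cA cf; have [A0|/set0P/negP] := pselect (A !=set0); last first.
  by rewrite negbK => /eqP ->; exists 0.
have [u _ Hu] := compact_EVT_max A0 cA cf.
have [l _ Hl] := compact_EVT_min A0 cA cf.
exists (`|f u| + `|f l|) => x At.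
have := Hu _ (mem_set At); have := Hl _ (mem_set At).
have := ler_norm (f u); have := ler_norm (- f l); rewrite normrN => A1 A2 A3 A4.
have := normr_ge0 (f u); have := normr_ge0 (f l) => B1 B2.
by rewrite ler_norml; apply/andP; split; lra.
Qed.

Lemma continuous_regular K j f : compact K -> {within K, continuous f} -> regular K j f.
Proof.
move=> cK cf; split; first exact: compact_bound.
by move=> t Kt _; move/subspace_continuousP : cf; exact.
Qed.

Lemma regular_refl K j f : regular K j f ->
  regular (refl K) (fun t => - j (- t)) (fun t => f (- t)).
Proof.
move=> [[M HM] cf]; split; first by exists M => t /HM.
move=> t Kt jt; have := cvg_refl (cf _ Kt _); rewrite opprK; apply.
by rewrite -[LHS]opprK jt.
Qed.

Lemma cvg_within_comp (S T : topologicalType) (K : set S) (A : set T) (m : S -> T) (s : S) (t : T) :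
  (forall x, K x -> A (m x)) -> m x @[x --> within K (nbhs s)] --> t ->
  m x @[x --> within K (nbhs s)] --> within A (nbhs t).
Proof.
move=> mA ms U tU.
have H : \forall x \near s, K x -> A (m x) -> U (m x) := ms _ tU.
suff : \forall x \near s, K x -> U (m x) by [].
apply: filterS H => x H Kx.
by apply: H => //; exact: mA.
Qed.

Lemma cvg_within_sub X K f t (l : R) : K `<=` X ->
  f s @[s --> within X (nbhs t)] --> l -> f s @[s --> within K (nbhs t)] --> l.
Proof.
move=> KX; apply: (cvg_comp id f).
by apply: cvg_within_comp; [exact: KX|exact: cvg_within].
Qed.

(** At a fixed point t of j the point (s, y(j s), v s) tends to (t, y t, v t), because
    j s tends to t there. Boundedness comes from the compactness of
    X x y(X) x v(K), up to enlarging the last two sets to intervals. *)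
Lemma lagrangian_regular X K j L y v : compact X -> compact K -> K `<=` X ->
  (forall t, K t -> X (j t)) ->
  (forall t, K t -> j t = t -> j s @[s --> within K (nbhs t)] --> t) ->
  {within X, continuous y} -> {within K, continuous v} ->
  continuous_lagrangian X L ->
  regular K j (fun t => L t (y (j t)) (v t)).
Proof.
move=> cX cK KX jX jc cy cv cL; split.
  have [M1 H1] := compact_bound cX cy; have [M2 H2] := compact_bound cK cv.
  pose B : set (R * (R * R)) := X `*` (`[- M1, M1] `*` `[- M2, M2]).
  have cB : compact B by apply: compact_setX => //; apply: compact_setX; exact: segment_compact.
  have [M HM] : exists M, forall p : R * (R * R), B p -> `|L p.1 p.2.1 p.2.2| <= M.
    apply: compact_bound => //; apply: continuous_subspaceW cL.
    by move=> p [].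
  exists M => t Kt; apply: (HM (t, (y (j t), v t))).
  split; first exact: KX.
  by split; rewrite /= in_itv /= -ler_norml; [apply: H1; exact: jX|exact: H2].
move=> t Kt jt.
pose m s : R * (R * R) := (s, (y (j s), v s)).
have cm : m s @[s --> within K (nbhs t)] --> m t.
  apply: (cvg_pair (G := nbhs t) (H := nbhs (y (j t), v t))); first exact: cvg_within.
  apply: (cvg_pair (G := nbhs (y (j t))) (H := nbhs (v t))); last by move/subspace_continuousP : cv; exact.
  move/subspace_continuousP : cy => /(_ t (KX _ Kt)) cy.
  rewrite /= jt; apply: cvg_comp cy.
  by apply: cvg_within_comp; [exact: jX|exact: jc].
move/subspace_continuousP : cL => /(_ (m t) (KX _ Kt)).
move=> Lm.
have mW : m s @[s --> within K (nbhs t)] --> within [set p | X p.1] (nbhs (m t)).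
  by apply: cvg_within_comp cm => s Ks; exact: KX.
exact: (cvg_comp _ _ mW Lm).
Qed.

End Regular.

(** * Existence of antiderivatives *)

Section Existence.
Context {R : realType}.
Implicit Types (X : set R) (f g F G : R -> R) (a b r s t u v m c e : R).

(** The upper Darboux sums of f between s and t. Generating them by concatenation,
    rather than from lists of nodes, makes both directions of the additivity of
    their infimum an induction. *)
Inductive upper_sum X f : R -> R -> R -> Prop :=
| upper_sum1 s t m : s <= t ->
    (forall r, X r -> s <= r -> r < t -> f r <= m) -> upper_sum X f s t (m * (t - s))
| upper_sum_cat s u t v w : X u -> s <= u -> u <= t -> upper_sum X f s u v -> upper_sum X f u t w ->
    upper_sum X f s t (v + w).

(** Inserting the node u does not change the sum: the interval that contains u
    keeps its bound m on both halves. *)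
Lemma upper_sum_split X f s t u v : upper_sum X f s t v -> s <= u -> u <= t ->
  exists v1 v2, [/\ upper_sum X f s u v1, upper_sum X f u t v2 & v1 + v2 = v].
Proof.
move=> H; elim: H u => {s t v}.
  move=> s t m st Hm u su ut; exists (m * (u - s)), (m * (t - u)); split.
  - by apply: upper_sum1 => // r Xr sr ru; apply: Hm => //; exact: lt_le_trans ut.
  - by apply: upper_sum1 => // r Xr ur rt; apply: Hm => //; exact: le_trans ur.
  - by ring.
move=> s u' t v w Xu' su' u't H1 IH1 H2 IH2 u su ut.
have [uu'|/ltW u'u] := leP u u'.
  have [v1 [v2 [V1 V2 <-]]] := IH1 u su uu'.
  exists v1, (v2 + w); split => //; last by ring.
  exact: (upper_sum_cat Xu').
have [w1 [w2 [W1 W2 <-]]] := IH2 u u'u ut.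
exists (v + w1), w2; split => //; last by ring.
exact: (upper_sum_cat Xu').
Qed.

Lemma upper_sum_ge X f s t v c : X s -> upper_sum X f s t v ->
  (forall r, X r -> s <= r -> r < t -> c <= f r) -> c * (t - s) <= v.
Proof.
move=> Xs H; elim: H Xs => {s t v}.
  move=> s t m st Hm Xs Hc; move: st; rewrite le_eqVlt => /orP[/eqP ->|st].
    by rewrite !subrr !mulr0.
  by rewrite ler_pM2r ?subr_gt0//; apply: le_trans (Hm s Xs _ st); rewrite ?Hc.
move=> s u t v w Xu su ut _ IH1 _ IH2 Xs Hc.
rewrite (_ : c * (t - s) = c * (u - s) + c * (t - u)); last by ring.
apply: lerD.
  by apply: IH1 => // r Xr sr ru; apply: Hc => //; exact: lt_le_trans ut.
by apply: IH2 => // r Xr ur rt; apply: Hc => //; exact: le_trans ur.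
Qed.

Definition upper_int X f s t : R := inf [set v | upper_sum X f s t v].

Section Bounded.
Context (X : set R) (a b : R) (f : R -> R) (M : R).
Context (sX : compact_scale X a b) (HM : forall t, upper_kappa X t -> `|f t| <= M).

Let fM t : X t -> t < b -> - M <= f t <= M.
Proof. by move=> Xt tb; rewrite -ler_norml; apply: HM; exact: (lt_upper_kappa sX). Qed.

Lemma has_inf_upper_sum s t : X s -> X t -> s <= t -> has_inf [set v | upper_sum X f s t v].
Proof.
move=> Xs Xt st; have tb := scale_le sX Xt; split.
  exists (M * (t - s)); apply: upper_sum1 => // r Xr _ rt.
  by have /andP[] := fM Xr (lt_le_trans rt tb).
exists (- M * (t - s)) => v Hv; apply: (upper_sum_ge Xs Hv) => r Xr _ rt.
by have /andP[] := fM Xr (lt_le_trans rt tb).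
Qed.

Lemma upper_intD s u t : X s -> X u -> X t -> s <= u -> u <= t ->
  upper_int X f s t = upper_int X f s u + upper_int X f u t.
Proof.
move=> Xs Xu Xt su ut; rewrite /upper_int -inf_sumE; last 2 first.
- exact: has_inf_upper_sum.
- exact: has_inf_upper_sum.
congr inf; apply/seteqP; split => v /=.
  by move=> /upper_sum_split/(_ su ut)[v1 [v2 [? ? ?]]]; exists v1 => //; exists v2.
by move=> [v1 ? [v2 ? <-]]; exact: (upper_sum_cat Xu).
Qed.

Lemma upper_int_near s t c e : X s -> X t -> s <= t ->
  (forall r, X r -> s <= r -> r < t -> `|f r - c| <= e) ->
  `|upper_int X f s t - c * (t - s)| <= e * (t - s).
Proof.
move=> Xs Xt st H; have hi := has_inf_upper_sum Xs Xt st.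
have A : (c - e) * (t - s) <= upper_int X f s t.
  apply: lb_le_inf; first by case: hi.
  move=> v Hv; apply: (upper_sum_ge Xs Hv) => r Xr sr rt.
  by have := H r Xr sr rt; rewrite ler_norml; lra.
have B : upper_int X f s t <= (c + e) * (t - s).
  apply: ge_inf; first by case: hi.
  apply: upper_sum1 => // r Xr sr rt.
  by have := H r Xr sr rt; rewrite ler_norml; lra.
by rewrite ler_norml; lra.
Qed.

(** Near a right-dense point f is nearly constant, hence so are the mean values of
    its upper integral. Over a gap of X the only value that counts is f t. *)
Lemma upper_int_deriv :
  (forall t, upper_kappa X t -> sigma X t = t -> f x @[x --> within (upper_kappa X) (nbhs t)] --> f t) ->
  is_delta_antideriv X f (upper_int X f a).
Proof.
have Xa : X a by case: sX.
have inc u v : X u -> X v -> u <= v -> upper_int X f a v - upper_int X f a u = upper_int X f u v.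
  by move=> Xu Xv uv; rewrite (@upper_intD a u v) ?(scale_ge sX)//; ring.
have M0 t : upper_kappa X t -> 0 <= M by move=> /HM; exact: le_trans.
move=> cf t Kt; have Xt := upper_kappa_sub Kt.
have [st|st] := eqVneq (sigma X t) t.
  apply: jump_deriv_dense => // e e0.
  have /cvgrPdist_le/(_ e e0)/near_within_ballP[r r0 Hr] := cf t Kt st.
  exists r => // u v Xu Xv uv ur vr; rewrite inc//.
  apply: upper_int_near => // x Xx ux xv; rewrite distrC; apply: Hr.
    by apply: (lt_upper_kappa sX) => //; exact: lt_le_trans (scale_le sX Xv).
  move: ur vr; rewrite !ltr_norml => /andP[? ?] /andP[? ?].
  by apply/andP; split; lra.
apply: jump_deriv_scattered => //.
  have lip u v : X u -> X v -> u <= v -> `|upper_int X f u v| <= M * (v - u).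
    move=> Xu Xv uv; have := @upper_int_near u v 0 M Xu Xv uv.
    rewrite mul0r subr0; apply => r Xr _ rv; rewrite subr0; apply: HM.
    by apply: (lt_upper_kappa sX) => //; exact: lt_le_trans (scale_le sX Xv).
  apply/cvgrPdist_le => e e0; apply/near_within_ballP.
  have c0 : 0 < M + 1 by rewrite ltr_wpDl// (M0 t).
  exists (e / (M + 1)); first exact: divr_gt0.
  have W x : 0 <= x -> x < e / (M + 1) -> M * x <= e.
    move=> x0; rewrite ltr_pdivlMr// => xe.
    by rewrite mulrC (le_trans _ (ltW xe))// ler_wpM2l// lerDl.
  move=> s Xs; have [ts|/ltW ts] := leP s t.
    rewrite distrC ger0_norm ?subr_ge0// => H.
    by rewrite inc// (le_trans (lip _ _ Xs Xt ts))// W// subr_ge0.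
  rewrite ger0_norm ?subr_ge0// => H.
  by rewrite distrC inc// (le_trans (lip _ _ Xt Xs ts))// W// subr_ge0.
have Xst := sigma_in sX Xt.
rewrite inc ?sigma_ge//.
apply/eqP; rewrite -subr_eq0 -normr_le0 -[leRHS](mul0r (sigma X t - t)).
apply: upper_int_near; rewrite ?sigma_ge// => r Xr tr rs.
(* t is the only point of X in [t, sigma t[. *)
suff -> : r = t by rewrite subrr normr0.
apply/eqP; rewrite eq_le tr andbT leNgt; apply/negP => /(sigma_le Xr).
by rewrite leNgt rs.
Qed.

End Bounded.

Lemma delta_antideriv_exists X a b f : compact_scale X a b ->
  regular (upper_kappa X) (sigma X) f -> exists F, is_delta_antideriv X f F.
Proof.
by move=> sX [[M HM] cf]; exists (upper_int X f a); exact: (upper_int_deriv sX HM cf).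
Qed.

Lemma nabla_antideriv_exists X a b f : compact_scale X a b ->
  regular (lower_kappa X) (rho X) f -> exists F, is_nabla_antideriv X f F.
Proof.
move=> /compact_scale_refl sX /regular_refl.
rewrite -upper_kappa_refl (_ : (fun t => - rho X (- t)) = sigma (refl X)); last first.
  by apply/funext => t; rewrite sigma_refl.
move=> /(delta_antideriv_exists sX)[F /nabla_antideriv_refl].
rewrite reflK (_ : (fun t => f (- - t)) = f); last by apply/funext => t; rewrite opprK.
by move=> HF; exists (fun t => - F (- t)).
Qed.

Lemma nabla_antideriv_cts X a b f F t : compact_scale X a b ->
  is_nabla_antideriv X f F -> X t -> F x @[x --> within X (nbhs t)] --> F t.
Proof.
move=> /compact_scale_refl sX /delta_antideriv_refl HF Xt.
have Xt' : refl X (- t) by rewrite /refl /= opprK.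
have := cvg_refl (delta_antideriv_cts sX HF Xt'); rewrite reflK !opprK.
move=> H; have /(_ _) := cvgN H; rewrite !opprK => {}H.
by move: H; rewrite (_ : (fun x => F (- - x)) = F)//; apply/funext => x; rewrite opprK.
Qed.

End Existence.

(** * From nabla to delta antiderivatives *)

Section Transfer.
Context {R : realType}.
Implicit Types (X : set R) (f g p q h D N G : R -> R) (a b c t : R).

(** At a right-scattered t the nabla derivative at sigma t is the difference quotient
    over the gap. At a right-dense t the nabla mean value inequality involves the
    values g s only at points s for which both s and rho s are close to t: hence the
    second hypothesis, which tolerates that t itself is left-scattered. *)
Lemma nabla_to_delta X a b f g G : compact_scale X a b ->
  (forall t, upper_kappa X t -> t < sigma X t -> g (sigma X t) = f t) ->
  (forall t, upper_kappa X t -> sigma X t = t -> forall e, 0 < e ->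
     exists2 r, 0 < r & forall s, lower_kappa X s -> `|s - t| < r ->
       `|rho X s - t| < r -> `|g s - f t| <= e) ->
  is_nabla_antideriv X g G -> is_delta_antideriv X f G.
Proof.
move=> sX H1 H2 HG t Kt; have Xt := upper_kappa_sub Kt.
have [st|st] := eqVneq (sigma X t) t.
  apply: jump_deriv_dense => // e e0; have [r r0 Hr] := H2 t Kt st e e0.
  exists r => // u v Xu Xv uv ur vr.
  apply: (nabla_mvt sX HG) => // x Xx ux xv.
  move: ur vr; rewrite !ltr_norml => /andP[? ?] /andP[? ?].
  have := rho_ge Xu ux; have := rho_le X x => ? ?.
  apply: Hr.
  - by apply: (gt_lower_kappa sX) => //; exact: le_lt_trans (scale_ge sX Xu) _.
  - by rewrite ltr_norml; apply/andP; split; lra.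
  - by rewrite ltr_norml; apply/andP; split; lra.
have {st}ts : t < sigma X t by rewrite lt_neqAle eq_sym st sigma_ge.
apply: jump_deriv_scattered; first by rewrite gt_eqF.
  exact: nabla_antideriv_cts sX HG Xt.
have Ls : lower_kappa X (sigma X t).
  apply: (gt_lower_kappa sX); first exact: (sigma_in sX).
  exact: le_lt_trans (scale_ge sX Xt) _.
have := jump_deriv_base (sigma_in sX Xt) (HG _ Ls).
rewrite (rho_sigma sX Xt ts) (H1 _ Kt ts); lra.
Qed.


(** Here h is the variation, d and n bound the integrands from below, and the
    hypothesis on p and q is the Euler-Lagrange equation. With Q an antiderivative
    of q h^nabla, the function G = c h - Q has nabla derivative p(rho t) h^nabla(t)
    and thus delta derivative p h^Delta, so that D - G and N - Q have nonnegative
    derivatives; and G + Q = c h vanishes at both ends. *)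
Lemma mixed_variation_ge0 X a b p q h hd hn c d D n N : compact_scale X a b -> a < b ->
  regular (upper_kappa X) (sigma X) p -> regular (lower_kappa X) (rho X) q ->
  is_delta_antideriv X hd h -> is_nabla_antideriv X hn h ->
  {within upper_kappa X, continuous hd} -> {within lower_kappa X, continuous hn} ->
  h a = 0 -> h b = 0 ->
  (forall t, lower_kappa X t -> p (rho X t) + q t = c) ->
  is_delta_antideriv X d D -> is_nabla_antideriv X n N ->
  (forall t, upper_kappa X t -> p t * hd t <= d t) ->
  (forall t, lower_kappa X t -> q t * hn t <= n t) ->
  0 <= (D b - D a) + (N b - N a).
Proof.
move=> sX ab [_ cp] rq Hd Hn chd chn ha hb EL HD HN dD nN.
(* A first transfer, from the continuity of h^nabla: h^Delta = h^nabla o sigma. *)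
have hdE t : upper_kappa X t -> hd t = hn (sigma X t).
  move=> Kt; have Xt := upper_kappa_sub Kt.
  suff H : is_delta_antideriv X (fun t => hn (sigma X t)) h.
    apply: (jump_deriv_unique Xt _ (Hd t Kt) (H t Kt)) => st r r0.
    exact: (upper_kappa_limit sX ab Kt st r0).
  apply: (nabla_to_delta sX _ _ Hn) => // {Kt Xt}t Kt st e e0.
  have Lt := dense_lower_kappa sX (upper_kappa_sub Kt) st.
  move/subspace_continuousP : chn => /(_ t Lt)/cvgrPdist_le/(_ e e0)/near_within_ballP[r r0 Hr].
  by exists r => // s Ls sr _; rewrite st distrC; exact: Hr.
have [Q HQ] : exists Q, is_nabla_antideriv X (fun t => q t * hn t) Q.
  apply: (nabla_antideriv_exists sX); apply: regularM => //.
  exact: continuous_regular (compact_lower_kappa sX) chn.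
pose G t := c * h t - Q t.
have HG : is_nabla_antideriv X (fun t => c * hn t - q t * hn t) G.
  move=> t Lt; have Xt : X t by case: Lt.
  by apply: jump_derivB (HQ t Lt) => //; apply: jump_derivZ => //; exact: Hn.
have {HG} HG : is_delta_antideriv X (fun t => p t * hd t) G.
  apply: (nabla_to_delta sX _ _ HG) => t Kt st; have Xt := upper_kappa_sub Kt.
    have Ls : lower_kappa X (sigma X t).
      apply: (gt_lower_kappa sX); first exact: (sigma_in sX).
      exact: le_lt_trans (scale_ge sX Xt) st.
    by rewrite -(EL _ Ls) (rho_sigma sX Xt st) hdE//; ring.
  (* p(rho s) h^nabla(s) -> p(t) h^nabla(t) as s and rho s tend to t *)
  move=> e e0; have Lt := dense_lower_kappa sX Xt st.
  pose C := `|hn t| + 1 + `|p t|.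
  have C0 : 0 < C by rewrite /C ltr_wpDr// ltr_wpDl.
  have eC : 0 < Num.min 1 (e / C) by rewrite lt_min ltr01 divr_gt0.
  have /cvgrPdist_le/(_ _ eC)/near_within_ballP[r1 r10 H1] := cp t Kt st.
  move/subspace_continuousP : chn => /(_ t Lt)/cvgrPdist_le/(_ _ eC)/near_within_ballP[r2 r20 H2].
  exists (Num.min r1 r2); first by rewrite lt_min r10.
  move=> s Ls; rewrite !lt_min => /andP[_ s2] /andP[s1 _].
  have Xs : X s by case: Ls.
  have := H1 _ (rho_upper_kappa sX Xs) s1; have := H2 _ Ls s2.
  rewrite !le_min => /andP[A1 A2] /andP[_ B].
  have hs : `|hn s| <= `|hn t| + 1.
    rewrite -[hn s](subrK (hn t)) (le_trans (ler_normD _ _))// addrC lerD2l//.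
    by rewrite distrC.
  rewrite -(EL _ Ls) hdE// st.
  rewrite (_ : _ - _ = (p (rho X s) - p t) * hn s + p t * (hn s - hn t)); last by ring.
  rewrite (le_trans (ler_normD _ _))// !normrM.
  apply: le_trans (_ : e / C * (`|hn t| + 1) + `|p t| * (e / C) <= _).
    by apply: lerD; [apply: ler_pM; rewrite // distrC|apply: ler_wpM2l; rewrite // distrC].
  by rewrite -[leRHS](@divfK _ C) ?gt_eqF// {4}/C le_eqVlt; apply/orP; left; apply/eqP; ring.
have A1 := delta_antideriv_le sX HG HD dD.
have A2 := nabla_antideriv_le sX HQ HN nN.
move: A1; rewrite /G ha hb; lra.
Qed.

Lemma continuous_within_refl X f : {within X, continuous f} ->
  {within refl X, continuous (fun t => f (- t))}.
Proof.
move=> /subspace_continuousP H; apply/subspace_continuousP => t Xt.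
by have := cvg_refl (H _ Xt); rewrite opprK.
Qed.

(** The previous inequality on the reflected scale, where p and q, h^Delta and h^nabla,
    D and N change places. *)
Lemma mixed_variation_ge0_sigma X a b p q h hd hn c d D n N : compact_scale X a b -> a < b ->
  regular (upper_kappa X) (sigma X) p -> regular (lower_kappa X) (rho X) q ->
  is_delta_antideriv X hd h -> is_nabla_antideriv X hn h ->
  {within upper_kappa X, continuous hd} -> {within lower_kappa X, continuous hn} ->
  h a = 0 -> h b = 0 ->
  (forall t, upper_kappa X t -> p t + q (sigma X t) = c) ->
  is_delta_antideriv X d D -> is_nabla_antideriv X n N ->
  (forall t, upper_kappa X t -> p t * hd t <= d t) ->
  (forall t, lower_kappa X t -> q t * hn t <= n t) ->
  0 <= (D b - D a) + (N b - N a).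
Proof.
move=> sX ab rp rq Hd Hn chd chn ha hb EL HD HN dD nN.
have Es : (fun t => - rho X (- t)) = sigma (refl X) by apply/funext => t; rewrite sigma_refl.
have Er : (fun t => - sigma X (- t)) = rho (refl X) by apply/funext => t; rewrite rho_refl.
have ba : - b < - a by rewrite ltrN2.
have rq' := regular_refl rq; rewrite Es -upper_kappa_refl in rq'.
have rp' := regular_refl rp; rewrite Er -lower_kappa_refl in rp'.
have chd' := continuous_within_refl chd; rewrite -lower_kappa_refl in chd'.
have chn' := continuous_within_refl chn; rewrite -upper_kappa_refl in chn'.
have := mixed_variation_ge0 (compact_scale_refl sX) ba rq' rp'
  (delta_antideriv_refl Hn) (nabla_antideriv_refl Hd) chn' chd' _ _ _
  (delta_antideriv_refl HN) (nabla_antideriv_refl HD).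
rewrite !opprK ha hb oppr0 => /(_ c erefl erefl) H.
rewrite addrC [N b - _]addrC [D b - _]addrC; apply: H.
- by move=> t; rewrite lower_kappa_refl rho_refl opprK addrC => /EL.
- by move=> t; rewrite upper_kappa_refl => /nN.
- by move=> t; rewrite lower_kappa_refl => /dD.
Qed.

End Transfer.

(** * Gradient inequality for convex functions *)

Section Convexity.
Context {R : realType}.
Implicit Types (f : R -> R) (g : R -> R -> R) (u v x e : R).

Lemma derivable_approx f x e : derivable f x 1 -> 0 < e ->
  exists2 r, 0 < r & forall k, `|k| < r -> `|f (x + k) - f x - derive1 f x * k| <= e * `|k|.
Proof.
move=> df e0.
have : (h^-1 *: (f (h + x) - f x)) @[h --> 0^'] --> derive1 f x.
  move: df; rewrite /derivable /derive1 /=.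
  by rewrite (_ : (fun h => h^-1 *: (f (h *: 1 + x) - f x)) = fun h => h^-1 *: (f (h + x) - f x))//;
     apply/funext => h; rewrite [_ *: 1]mulr1.
move=> /cvgrPdist_le/(_ e e0); rewrite near_withinE => /nbhs_ballP[r /= r0 H].
exists r => // k kr; have [->|k0] := eqVneq k 0.
  by rewrite addr0 subrr mulr0 subr0 normr0 mulr0.
have := H k; rewrite /ball /= sub0r normrN => /(_ kr k0).
rewrite -(ler_pM2r (x := `|k|)) ?normr_gt0// -normrM distrC [k + x]addrC.
by rewrite mulrBl [_ *: _]mulrC mulfVK.
Qed.

Lemma convex_function2P g :
  @convex_function R (R^o * R^o)%type setT (fun p => g p.1 p.2) ->
  forall l u v u' v', 0 <= l -> l <= 1 ->
    g (l * u + (1 - l) * u') (l * v + (1 - l) * v') <= l * g u v + (1 - l) * g u' v'.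
Proof.
move=> H l u v u' v' l0 l1.
have L : Itv.spec (Itv.num_sem (R := R)) (Itv.Real `[0%Z, 1%Z]) l.
  by rewrite /= /Itv.num_sem /= in_itv /= l0 l1 ger0_real.
have := H (Itv.mk L) (u, v) (u', v').
by apply; rewrite inE.
Qed.

(** Put w = (u'-u, v'-v) and P = (u, v). By convexity, for 0 < l <= 1,
    l (g(P+w) - g(P)) >= g(P+lw) - g(P) >= g(P) - g(P-lw), and g(P-lw) is at most the
    mean of g at two points that differ from P in one coordinate, by -2l(u'-u) and
    -2l(v'-v). Dividing by l -> 0, only the two partial derivatives are involved. *)
Lemma convex_subgradient g u v :
  (forall l u v u' v', 0 <= l -> l <= 1 ->
    g (l * u + (1 - l) * u') (l * v + (1 - l) * v') <= l * g u v + (1 - l) * g u' v') ->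
  derivable (fun x => g x v) u 1 -> derivable (fun x => g u x) v 1 ->
  forall u' v', g u v + derive1 (fun x => g x v) u * (u' - u)
    + derive1 (fun x => g u x) v * (v' - v) <= g u' v'.
Proof.
move=> cg d2 d3 u' v'.
set D2 := derive1 _ u; set D3 := derive1 _ v.
set w := u' - u; set z := v' - v.
suff W e : 0 < e -> g u v + D2 * w + D3 * z <= g u' v' + e * (`|w| + `|z|).
  apply/ler_addgt0Pl => e e0.
  have c0 : 0 < `|w| + `|z| + 1 by rewrite ltr_wpDl// addr_ge0.
  rewrite [e + _]addrC (le_trans (W _ (divr_gt0 e0 c0)))// lerD2l.
  by rewrite mulrAC ler_pdivrMr// ler_pM2l// lerDl.
move=> e0.
have [r2 r20 H2] := derivable_approx d2 e0.
have [r3 r30 H3] := derivable_approx d3 e0.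
pose l := Num.min 1 (Num.min (r2 / (4 * (`|w| + 1))) (r3 / (4 * (`|z| + 1)))).
have p2 : 0 < 4 * (`|w| + 1) by rewrite mulr_gt0// ltr_wpDl.
have p3 : 0 < 4 * (`|z| + 1) by rewrite mulr_gt0// ltr_wpDl.
have l0 : 0 < l by rewrite !lt_min ltr01 !divr_gt0.
have l1 : l <= 1 by rewrite ge_min lexx.
have l2 : l * (4 * (`|w| + 1)) <= r2 by rewrite -ler_pdivlMr// !ge_min lexx !orbT.
have l3 : l * (4 * (`|z| + 1)) <= r3 by rewrite -ler_pdivlMr// !ge_min lexx !orbT.
have n2 : `|- 2 * l * w| = 2 * l * `|w| by rewrite !normrM normrN (gtr0_norm l0) normr_nat.
have n3 : `|- 2 * l * z| = 2 * l * `|z| by rewrite !normrM normrN (gtr0_norm l0) normr_nat.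
have w0 := normr_ge0 w; have z0 := normr_ge0 z.
have {}H2 : g (u - 2 * l * w) v <= g u v - 2 * l * (D2 * w) + e * (2 * l * `|w|).
  have := H2 (- 2 * l * w); rewrite n2 => /(_ _)/ler_normlW.
  rewrite (_ : u + -2 * l * w = u - 2 * l * w); last by ring.
  by move=> /(_ ltac:(nra)); rewrite -/D2; lra.
have {}H3 : g u (v - 2 * l * z) <= g u v - 2 * l * (D3 * z) + e * (2 * l * `|z|).
  have := H3 (- 2 * l * z); rewrite n3 => /(_ _)/ler_normlW.
  rewrite (_ : v + -2 * l * z = v - 2 * l * z); last by ring.
  by move=> /(_ ltac:(nra)); rewrite -/D3; lra.
have C1 := cg l u' v' u v (ltW l0) l1.
have C2 : g u v <= (1 / 2) * g (l * u' + (1 - l) * u) (l * v' + (1 - l) * v)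
    + (1 / 2) * g (u - l * w) (v - l * z).
  have := cg (1 / 2) (l * u' + (1 - l) * u) (l * v' + (1 - l) * v) (u - l * w) (v - l * z).
  rewrite (_ : 1 / 2 * _ + _ * (u - _) = u); last by rewrite /w; field.
  rewrite (_ : 1 / 2 * _ + _ * (v - _) = v); last by rewrite /z; field.
  by rewrite (_ : 1 - 1 / 2 = 1 / 2); [apply; lra|field].
have C3 : g (u - l * w) (v - l * z) <= (1 / 2) * g (u - 2 * l * w) v + (1 / 2) * g u (v - 2 * l * z).
  have := cg (1 / 2) (u - 2 * l * w) v u (v - 2 * l * z).
  rewrite (_ : 1 / 2 * _ + _ * u = u - l * w); last by field.
  rewrite (_ : 1 / 2 * _ + _ * (v - _) = v - l * z); last by field.
  by rewrite (_ : 1 - 1 / 2 = 1 / 2); [apply; lra|field].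
suff : l * (g u v + D2 * w + D3 * z) <= l * (g u' v' + e * (`|w| + `|z|)) by rewrite ler_pM2l.
lra.
Qed.

End Convexity.

(** * Comparison of the functionals *)

Section Sufficiency.
Context {R : realType}.
Implicit Types (X K : set R) (j f g y v F A : R -> R) (L : R -> R -> R -> R) (a b c k t : R).

(** The factor k is a nonnegative weight for convex L and a nonpositive one for concave
    L, which lets the two cases share one proof. *)
Definition subgradient_ineq X k L := forall t (u v u' v' : R), X t ->
  k * (L t u v + partial2 L t u v * (u' - u) + partial3 L t u v * (v' - v)) <= k * L t u' v'.

(** Let F, F0 be antiderivatives of L along y and y0, and A one of d2 L along y0. In
    D = k (F - F0 - (A - A a) (y - y0)) the product rule cancels the term
    d2 L (y - y0)(j t) of the gradient inequality, which is integration by parts; the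
    product vanishes at a and b. *)
Lemma jump_variation X K j k L y y0 v v0 a b F F0 A : K `<=` X ->
  subgradient_ineq X k L ->
  (forall t, K t -> jump_deriv X j y t (v t)) ->
  (forall t, K t -> jump_deriv X j y0 t (v0 t)) ->
  (forall t, K t -> jump_deriv X j F t (L t (y (j t)) (v t))) ->
  (forall t, K t -> jump_deriv X j F0 t (L t (y0 (j t)) (v0 t))) ->
  (forall t, K t -> jump_deriv X j A t (partial2 L t (y0 (j t)) (v0 t))) ->
  y a = y0 a -> y b = y0 b ->
  exists D d, [/\ forall t, K t -> jump_deriv X j D t (d t),
    forall t, K t ->
      k * (partial3 L t (y0 (j t)) (v0 t) - (A t - A a)) * (v t - v0 t) <= d t &
    D b - D a = k * ((F b - F a) - (F0 b - F0 a))].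
Proof.
move=> KX sL Hy Hy0 HF HF0 HA ya yb.
exists (fun t => k * ((F t - F0 t) - (A t - A a) * (y t - y0 t))).
exists (fun t => k * ((L t (y (j t)) (v t) - L t (y0 (j t)) (v0 t)) -
  ((partial2 L t (y0 (j t)) (v0 t) - 0) * (y (j t) - y0 (j t)) + (A t - A a) * (v t - v0 t)))).
split.
- move=> t Kt; have Xt := KX t Kt.
  apply: jump_derivZ => //; apply: jump_derivB => //.
    by apply: jump_derivB => //; [exact: HF|exact: HF0].
  apply: jump_derivM => //.
    by apply: jump_derivB => //; [exact: HA|exact: jump_deriv_cst].
  by apply: jump_derivB => //; [exact: Hy|exact: Hy0].
- move=> t Kt; have := sL t (y0 (j t)) (v0 t) (y (j t)) (v t) (KX t Kt); lra.
- by rewrite ya yb !subrr !mulr0 !subr0; ring.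
Qed.

Lemma C1_delta_antideriv X y : C1_diamond X y -> is_delta_antideriv X (delta_deriv X y) y.
Proof. by move=> [H _ _ _] t /H; exact: xgetPex. Qed.

Lemma C1_nabla_antideriv X y : C1_diamond X y -> is_nabla_antideriv X (nabla_deriv X y) y.
Proof. by move=> [_ _ H _] t /H; exact: xgetPex. Qed.

Lemma C1_continuous X a b y : compact_scale X a b -> C1_diamond X y -> {within X, continuous y}.
Proof.
move=> sX /C1_delta_antideriv H; apply/subspace_continuousP => t Xt.
exact: (delta_antideriv_cts sX H).
Qed.

Lemma at_delta_regular X a b L y : compact_scale X a b -> C1_diamond X y ->
  continuous_lagrangian X L -> regular (upper_kappa X) (sigma X) (at_delta X L y).
Proof.
move=> sX Cy cL; apply: (@lagrangian_regular _ X _ (sigma X) L y (delta_deriv X y)) => //.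
- exact: (compact_scale_compact sX).
- exact: (compact_upper_kappa sX).
- exact: upper_kappa_sub.
- by move=> t [Xt _]; exact: (sigma_in sX).
- move=> t Kt st; apply: (cvg_within_sub (@upper_kappa_sub _ X)).
  exact: (sigma_cvg sX (upper_kappa_sub Kt) st).
- exact: C1_continuous sX Cy.
- by case: Cy.
Qed.

Lemma at_nabla_regular X a b L y : compact_scale X a b -> C1_diamond X y ->
  continuous_lagrangian X L -> regular (lower_kappa X) (rho X) (at_nabla X L y).
Proof.
move=> sX Cy cL; apply: (@lagrangian_regular _ X _ (rho X) L y (nabla_deriv X y)) => //.
- exact: (compact_scale_compact sX).
- exact: (compact_lower_kappa sX).
- by move=> t [].
- by move=> t [Xt _]; exact: (rho_in sX).
- move=> t [Xt _] rt; apply: (@cvg_within_sub _ X); first by move=> s [].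
  exact: (rho_cvg sX Xt rt).
- exact: C1_continuous sX Cy.
- by case: Cy.
Qed.

Lemma regularB_cst K j f g c : regular K j f -> regular K j g ->
  regular K j (fun t => f t - (g t - c)).
Proof.
move=> rf rg; have := regularD rf (regularD (regularM (regular_cst K j (-1)) rg) (regular_cst K j c)).
by rewrite (_ : (fun t => _ + _) = (fun t => f t - (g t - c)))//; apply/funext => t; ring.
Qed.

(** The Euler-Lagrange expression itself is replaced by a p that agrees with it on X:
    its integral term is an antiderivative there, hence continuous. *)
Lemma delta_variation X a b k L y y0 : compact_scale X a b ->
  smooth_lagrangian X L -> subgradient_ineq X k L ->
  C1_diamond X y -> C1_diamond X y0 -> y a = y0 a -> y b = y0 b ->
  exists p D d, [/\ forall t, X t -> EL_delta X a L y0 t = p t,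
    regular (upper_kappa X) (sigma X) p,
    is_delta_antideriv X d D,
    forall t, upper_kappa X t -> k * p t * (delta_deriv X y t - delta_deriv X y0 t) <= d t &
    D b - D a = k * (delta_integral X (at_delta X L y) a b - delta_integral X (at_delta X L y0) a b)].
Proof.
move=> sX [cL _ cL2 cL3] sL Cy Cy0 ya yb; have [_ Xa Xb _] := sX.
have [F HF] := delta_antideriv_exists sX (at_delta_regular sX Cy cL).
have [F0 HF0] := delta_antideriv_exists sX (at_delta_regular sX Cy0 cL).
have [A HA] := delta_antideriv_exists sX (at_delta_regular sX Cy0 cL2).
have [D [d [HD dD DE]]] := jump_variation (@upper_kappa_sub _ X) sL (C1_delta_antideriv Cy)
  (C1_delta_antideriv Cy0) HF HF0 HA ya yb.
exists (fun t => at_delta X (partial3 L) y0 t - (A t - A a)), D, d; split => //.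
- by move=> t Xt; rewrite /EL_delta (delta_integralE sX HA Xt).
- apply: regularB_cst; first exact: at_delta_regular sX Cy0 cL3.
  apply: continuous_regular; first exact: compact_upper_kappa sX.
  apply: (continuous_subspaceW (@upper_kappa_sub _ X)); apply/subspace_continuousP => t Xt.
  exact: delta_antideriv_cts sX HA Xt.
- by rewrite DE (delta_integralE sX HF Xb) (delta_integralE sX HF0 Xb).
Qed.

Lemma nabla_variation X a b k L y y0 : compact_scale X a b ->
  smooth_lagrangian X L -> subgradient_ineq X k L ->
  C1_diamond X y -> C1_diamond X y0 -> y a = y0 a -> y b = y0 b ->
  exists q N n, [/\ forall t, X t -> EL_nabla X a L y0 t = q t,
    regular (lower_kappa X) (rho X) q,
    is_nabla_antideriv X n N,
    forall t, lower_kappa X t -> k * q t * (nabla_deriv X y t - nabla_deriv X y0 t) <= n t &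
    N b - N a = k * (nabla_integral X (at_nabla X L y) a b - nabla_integral X (at_nabla X L y0) a b)].
Proof.
move=> sX [cL _ cL2 cL3] sL Cy Cy0 ya yb; have [_ Xa Xb _] := sX.
have [F HF] := nabla_antideriv_exists sX (at_nabla_regular sX Cy cL).
have [F0 HF0] := nabla_antideriv_exists sX (at_nabla_regular sX Cy0 cL).
have [A HA] := nabla_antideriv_exists sX (at_nabla_regular sX Cy0 cL2).
have KX : lower_kappa X `<=` X by move=> t [].
have [N [n [HN nN NE]]] := jump_variation KX sL (C1_nabla_antideriv Cy)
  (C1_nabla_antideriv Cy0) HF HF0 HA ya yb.
exists (fun t => at_nabla X (partial3 L) y0 t - (A t - A a)), N, n; split => //.
- by move=> t Xt; rewrite /EL_nabla (nabla_integralE sX HA Xt).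
- apply: regularB_cst; first exact: at_nabla_regular sX Cy0 cL3.
  apply: continuous_regular; first exact: compact_lower_kappa sX.
  apply: (continuous_subspaceW KX); apply/subspace_continuousP => t Xt.
  exact: nabla_antideriv_cts sX HA Xt.
- by rewrite NE (nabla_integralE sX HF Xb) (nabla_integralE sX HF0 Xb).
Qed.

Lemma within_continuousB K f g : {within K, continuous f} -> {within K, continuous g} ->
  {within K, continuous (fun t => f t - g t)}.
Proof.
move=> /subspace_continuousP cf /subspace_continuousP cg; apply/subspace_continuousP => t Kt.
by apply: cvgB; [exact: cf|exact: cg].
Qed.

Lemma EL_sufficient X a b (g1 g2 : R) Ld Ln k y y0 : compact_scale X a b -> a < b ->
  smooth_lagrangian X Ld -> smooth_lagrangian X Ln -> 0 <= g1 -> 0 <= g2 ->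
  C1_diamond X y0 ->
  (exists c, forall t, lower_kappa X t ->
     g1 * EL_delta X a Ld y0 (rho X t) + g2 * EL_nabla X a Ln y0 t = c) \/
  (exists c, forall t, upper_kappa X t ->
     g1 * EL_delta X a Ld y0 t + g2 * EL_nabla X a Ln y0 (sigma X t) = c) ->
  subgradient_ineq X k Ld -> subgradient_ineq X k Ln ->
  C1_diamond X y -> y a = y0 a -> y b = y0 b ->
  k * delta_nabla_functional X a b g1 g2 Ld Ln y0 <= k * delta_nabla_functional X a b g1 g2 Ld Ln y.
Proof.
move=> sX ab sLd sLn g10 g20 Cy0 EL kLd kLn Cy ya yb.
have scaleL (g : R) L : 0 <= g -> subgradient_ineq X k L -> subgradient_ineq X (k * g) L.
  move=> g0 H t u v u' v' Xt; rewrite ![k * g]mulrC -!mulrA ler_wpM2l//; exact: H.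
have [p [D [d [ELp rp HD dD DE]]]] := delta_variation sX sLd (scaleL _ _ g10 kLd) Cy Cy0 ya yb.
have [q [N [n [ELq rq HN nN NE]]]] := nabla_variation sX sLn (scaleL _ _ g20 kLn) Cy Cy0 ya yb.
have rp' := regularM (regular_cst _ _ (k * g1)) rp.
have rq' := regularM (regular_cst _ _ (k * g2)) rq.
have Hd : is_delta_antideriv X (fun t => delta_deriv X y t - delta_deriv X y0 t) (fun t => y t - y0 t).
  move=> t Kt; apply: jump_derivB; [exact: upper_kappa_sub Kt|exact: C1_delta_antideriv Cy t Kt|].
  exact: C1_delta_antideriv Cy0 t Kt.
have Hn : is_nabla_antideriv X (fun t => nabla_deriv X y t - nabla_deriv X y0 t) (fun t => y t - y0 t).
  move=> t Kt; apply: jump_derivB; [by case: Kt|exact: C1_nabla_antideriv Cy t Kt|].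
  exact: C1_nabla_antideriv Cy0 t Kt.
have chd : {within upper_kappa X, continuous (fun t => delta_deriv X y t - delta_deriv X y0 t)}.
  by apply: within_continuousB; [case: Cy|case: Cy0].
have chn : {within lower_kappa X, continuous (fun t => nabla_deriv X y t - nabla_deriv X y0 t)}.
  by apply: within_continuousB; [case: Cy|case: Cy0].
have ha : y a - y0 a = 0 by rewrite ya subrr.
have hb : y b - y0 b = 0 by rewrite yb subrr.
suff : 0 <= (D b - D a) + (N b - N a) by rewrite DE NE /delta_nabla_functional; lra.
case: EL => -[c EL].
  apply: (mixed_variation_ge0 sX ab rp' rq' Hd Hn chd chn ha hb (c := k * c)) HD HN dD nN.
  move=> t Lt; have Xt : X t by case: Lt.
  by rewrite -(EL t Lt) (ELp _ (rho_in sX Xt)) (ELq t Xt); ring.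
apply: (mixed_variation_ge0_sigma sX ab rp' rq' Hd Hn chd chn ha hb (c := k * c)) HD HN dD nN.
move=> t Kt; have Xt := upper_kappa_sub Kt.
by rewrite -(EL t Kt) (ELq _ (sigma_in sX Xt)) (ELp t Xt); ring.
Qed.

Lemma convex_subgradient_ineq X L : smooth_lagrangian X L -> jointly_convex X L ->
  subgradient_ineq X 1 L.
Proof.
move=> [_ dL _ _] cL t u v u' v' Xt; rewrite !mul1r.
have [d2 d3] := dL t u v Xt.
exact: (convex_subgradient (convex_function2P (g := L t) (cL t Xt)) d2 d3).
Qed.

Lemma concave_subgradient_ineq X L : smooth_lagrangian X L -> jointly_concave X L ->
  subgradient_ineq X (-1) L.
Proof.
move=> [_ dL _ _] cL t u v u' v' Xt.
have [d2 d3] := dL t u v Xt.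
have N2 : derive1 (fun x => - L t x v) u = - derive1 (fun x => L t x v) u := derive1N d2.
have N3 : derive1 (fun x => - L t u x) v = - derive1 (fun x => L t u x) v := derive1N d3.
have := convex_subgradient (convex_function2P (g := fun x z => - L t x z) (cL t Xt))
  (derivableN d2) (derivableN d3) u' v'.
rewrite /= N2 N3 /partial2 /partial3; lra.
Qed.

End Sufficiency.

Theorem theorem10 (R : realType) (T : set R) (a b : R) (I : set R)
  (Ld Ln : R -> R -> R -> R) (g1 g2 alpha beta : R) (yhat : R -> R)
  (tsT : time_scale T)
  (infT : has_lbound T /\ inf T = a) (Ta : T a)
  (supT : has_ubound T /\ sup T = b) (Tb : T b)
  (ltab : a < b) (Tab : T `&` `]a, b[ !=set0)
  (defI : I = `[a, b] `&` T)
  (smoothLd : smooth_lagrangian T Ld) (smoothLn : smooth_lagrangian T Ln)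
  (g1_ge0 : 0 <= g1) (g2_ge0 : 0 <= g2)
  (yhatC1 : C1_diamond I yhat)
  (yhata : yhat a = alpha) (yhatb : yhat b = beta)
  (EL :
    (exists c, forall t, lower_kappa I t ->
       g1 * EL_delta I a Ld yhat (rho I t) + g2 * EL_nabla I a Ln yhat t = c)
    \/
    (exists c, forall t, upper_kappa I t ->
       g1 * EL_delta I a Ld yhat t + g2 * EL_nabla I a Ln yhat (sigma I t) = c)) :
  (jointly_convex I Ld -> jointly_convex I Ln ->
   forall y, C1_diamond I y -> y a = alpha -> y b = beta ->
     delta_nabla_functional I a b g1 g2 Ld Ln yhat
       <= delta_nabla_functional I a b g1 g2 Ld Ln y) /\
  (jointly_concave I Ld -> jointly_concave I Ln ->
   forall y, C1_diamond I y -> y a = alpha -> y b = beta ->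
     delta_nabla_functional I a b g1 g2 Ld Ln y
       <= delta_nabla_functional I a b g1 g2 Ld Ln yhat).
Proof.
have Tin t : T t -> a <= t <= b.
  move=> Tt; case: infT => lT <-; case: supT => uT <-.
  by rewrite (ge_inf lT Tt) (ub_le_sup uT Tt).
have IT : I = T.
  by rewrite defI; apply/seteqP; split => [t []//|t Tt]; split => //=; rewrite in_itv /= Tin.
subst I; rewrite {}IT in yhatC1 EL *.
have sT : compact_scale T a b by split => //; case: tsT.
split=> cLd cLn y Cy ya yb.
  rewrite -[leLHS]mul1r -[leRHS]mul1r.
  apply: (EL_sufficient sT ltab smoothLd smoothLn) => //; rewrite ?yhata ?yhatb//.
  - exact: convex_subgradient_ineq.
  - exact: convex_subgradient_ineq.
rewrite -lerN2 -[leLHS]mulN1r -[leRHS]mulN1r.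
apply: (EL_sufficient sT ltab smoothLd smoothLn) => //; rewrite ?yhata ?yhatb//.
- exact: concave_subgradient_ineq.
- exact: concave_subgradient_ineq.
Qed.
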